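(* Let $d\ge1$, let $\mu$ and $\nu$ be probability distributions supported on a compact set $\mathcal{X}\subset\mathbb{R}^d$ of Euclidean diameter at most $1$, and let $\mu_n$ and $\nu_n$ be empirical distributions of $\mu$ and $\nu$ on $n$ samples. Then for any constants $p\ge1$ and $k>0$, with high probability $$\left|\mathrm{RPW}_{p,k}(\mu,\nu)-\mathrm{RPW}_{p,k}(\mu_n,\nu_n)\right|=\begin{cases}\tilde O(n^{-1/d}), & p\le d/2,\\ \tilde O\!\left(n^{-\frac{p}{p(d+2)-d}}\right), & p>d/2.\end{cases}$$
   Context: The metric is the Euclidean distance $c$. For $p\in[1,\infty)$ and $\alpha\in[0,1]$, a partial transport plan of mass $\alpha$ between probability distributions $\mu,\nu$ is a nonnegative measure $\gamma$ on $\mathcal{X}\times\mathcal{X}$ of total mass $\alpha$ with first marginal $\le\mu$ and second marginal $\le\nu$ (setwise); its cost is $w_p(\gamma)=(\int c^p\,d\gamma)^{1/p}$, and $W_{p,\alpha}(\mu,\nu)$ is the infimum of $w_p(\gamma)$ over such $\gamma$. For $k\ge0$, $\mathrm{RPW}_{p,k}(\mu,\nu)=\inf\{\varepsilon\in[0,1]: W_{p,1-\varepsilon}(\mu,\nu)\le k\varepsilon\}$. An empirical distribution $\mu_n$ is $\frac1n\sum_{i=1}^n\delta_{x_i}$ with $x_i$ i.i.d. from $\mu$ (samples for $\mu_n$, $\nu_n$ drawn independently). $\tilde O(\cdot)$ hides polylogarithmic factors in $n$; ''with high probability'' means with probability at least $1-n^{-c}$ for some constant $c>0$. *)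

(* Defs.v *)
From HB Require Import structures.
From mathcomp Require Import all_boot all_order all_algebra.
From mathcomp Require Import all_classical all_reals all_analysis.
Set Implicit Arguments. Unset Strict Implicit. Unset Printing Implicit Defensive.
Import Order.TTheory GRing.Theory Num.Theory.
Import numFieldNormedType.Exports.
Local Open Scope classical_set_scope.
Local Open Scope ring_scope.

Section Defs.
Variable R : realType.

(* R^d as row vectors, equipped with its Borel sigma-algebra (generated by
   the open sets of the (product = Euclidean) topology of 'rV[R]_d). *)
Definition Rd (d : nat) := g_sigma_algebraType (@open 'rV[R]_d).

Definition eucl_dist (d : nat) (x y : 'rV[R]_d) : R :=
  Num.sqrt (\sum_(i < d) (x ord0 i - y ord0 i) ^+ 2).

Definition partial_plan (d : nat) (mu nu : set (Rd d) -> \bar R) (alpha : R)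
    (gamma : {measure set (Rd d * Rd d)%type -> \bar R}) : Prop :=
  gamma setT = alpha%:E /\
  (forall A : set (Rd d), measurable A ->
     (gamma (A `*` setT) <= mu A)%E /\ (gamma (setT `*` A) <= nu A)%E).

Definition wcost (d : nat) (p : R)
    (gamma : {measure set (Rd d * Rd d)%type -> \bar R}) : \bar R :=
  ((\int[gamma]_z ((eucl_dist z.1 z.2) `^ p)%:E) `^ p^-1)%E.

Definition Wpa (d : nat) (p alpha : R) (mu nu : set (Rd d) -> \bar R) : \bar R :=
  ereal_inf [set wcost p gamma | gamma in partial_plan mu nu alpha].

Definition RPW (d : nat) (p k : R) (mu nu : set (Rd d) -> \bar R) : \bar R :=
  ereal_inf [set eps%:E | eps in
    [set eps : R | 0 <= eps <= 1 /\ (Wpa p (1 - eps) mu nu <= (k * eps)%:E)%E]].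

Definition empirical (d n : nat) (x : 'I_n -> Rd d) : set (Rd d) -> \bar R :=
  fun A => ((#|[set i : 'I_n | x i \in A]|)%:R / n%:R)%:E.

Definition rpw_rate (d : nat) (p : R) (n : nat) : R :=
  if p <= d%:R / 2 then n%:R `^ (- (d%:R)^-1)
  else n%:R `^ (- (p / (p * (d%:R + 2) - d%:R))).

(* X_1..X_n, Y_1..Y_n are mutually independent random variables on (Omega,P)
   (product rule for preimages of Borel sets; for a finite family this is
   equivalent to the product rule over every subfamily, taking A_i = setT). *)
Definition indep_samples (dO : measure_display) (O : measurableType dO)
    (P : probability O R) (d n : nat) (X Y : 'I_n -> O -> Rd d) : Prop :=
  forall A B : 'I_n -> set (Rd d),
    (forall i, measurable (A i)) -> (forall i, measurable (B i)) ->
    fine (P ((\bigcap_i (X i @^-1` A i)) `&` (\bigcap_i (Y i @^-1` B i)))) =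
      (\prod_(i < n) fine (P (X i @^-1` A i))) *
      (\prod_(i < n) fine (P (Y i @^-1` B i))).

Definition has_law (dO : measure_display) (O : measurableType dO)
    (P : probability O R) (d : nat) (Z : O -> Rd d) (mu : probability (Rd d) R)
    : Prop :=
  measurable_fun setT Z /\
  forall A : set (Rd d), measurable A -> P (Z @^-1` A) = mu A.

End Defs.

(* Main.v *)
(* Cut K into dyadic cells and couple mu with mu_n by matching mass greedily from
   the finest level J up to a level j0: what is left after level j is the total
   excess of mu over mu_n on the cells of level j, so the matching moves the excess
   of level j + 1 over a distance of order 2 ^ (- j) and drops the excess of level
   j0.  Each excess is mu(A) - mu_n(A) for a union A of cells, so Chernoff's bound
   and a union bound over the 2 ^ (2 ^ (d j)) such A give an excess of order
   (2 ^ (d j) ln n / n) ^ (1 / 2) at all levels, with probability 1 - 1 / n.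
   Balancing the dropped mass against the transport cost (with 2 ^ j0 = 1 if
   p <= d / 2 and 2 ^ (- j0) = rate ^ (1 - 1 / p) otherwise) gives the rate.
   These couplings are block-constant on cells, so composing them with a partial
   plan between mu and nu only takes finite sums of product measures and
   Minkowski's inequality for finite sums; no disintegration is needed. *)

Require Import Defs.
From HB Require Import structures.
From mathcomp Require Import all_boot all_order all_algebra.
From mathcomp Require Import all_classical all_reals all_analysis.
From mathcomp Require Import measurable_realfun ring lra.
Set Implicit Arguments. Unset Strict Implicit. Unset Printing Implicit Defensive.
Import Order.TTheory GRing.Theory Num.Theory.
Import numFieldNormedType.Exports.
Local Open Scope classical_set_scope.
Local Open Scope ring_scope.

(** [RPW] absorbs both defects of a coupling at once: raising eps by delta lowers the mass to be
    moved by delta and raises the budget by k * delta. Couplings of mu with mu_n and of nu with nu_n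
    that each drop mass s and cost B are therefore paid for once 2 * s <= delta and k * delta covers
    the added cost. This bounds one [RPW] by the other in one direction only; a coupling can be read
    backwards, so the same argument started from the empirical measures gives the other direction.
    The threshold p = d / 2 comes from the cost of a single level, of order 2 ^ (- j p) * 2 ^ (d j /
    2) * n ^ (- 1 / 2) up to logarithms. It is largest at the finest level when p <= d / 2, so
    stopping the matching early gains nothing; it is largest at the coarsest level when p > d / 2,
    where dropping the coarse excess is cheaper than moving it. Only O(ln n) levels occur, so every
    level is bounded by the worst one and the sum costs a logarithm: no geometric series is needed
    and p = d / 2 is not a special case. *)

(** * Minkowski's inequality and composition of couplings on finite sets *)

Section finite_couplings.
Variable R : realType.

(** Convexity of the p-th power at (x + y) / (A + B), the mean of x / A and y / B with weights A /
    (A + B) and B / (A + B). *)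
Lemma powR_add_le (p A B x y : R) : 1 <= p -> 0 < A -> 0 < B -> 0 <= x -> 0 <= y ->
  (x + y) `^ p <=
  (A + B) `^ p * (A / (A + B) * (x `^ p / A `^ p) + B / (A + B) * (y `^ p / B `^ p)).
Proof.
move=> p1 A0 B0 x0 y0; have AB0 : 0 < A + B by rewrite addr_gt0.
have [[A1 B1] AB1] := (ltW A0, ltW B0, ltW AB0).
have t01 : 0 <= A / (A + B) <= 1.
  by rewrite divr_ge0//= ler_pdivrMr// mul1r lerDl.
have := @convex_powR R p p1 (Itv01 (andP t01).1 (andP t01).2) (x / A) (y / B).
rewrite !inE/= !in_itv/= !andbT !divr_ge0// => /(_ isT isT).
rewrite convRE [X in X `^ _ <= _ -> _]convRE /= /unstable.onem.
have -> : 1 - A / (A + B) = B / (A + B) by field; rewrite gt_eqF.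
have -> : A / (A + B) * (x / A) + B / (A + B) * (y / B) = (x + y) / (A + B).
  by field; rewrite !gt_eqF.
have VE c : 0 <= c -> c^-1 `^ p = (c `^ p)^-1.
  by move=> c0; rewrite -(powR_inv1 c0) powRAC (powR_inv1 (powR_ge0 _ _)).
rewrite !powRM ?invr_ge0 ?addr_ge0// !VE// => h.
by rewrite mulrC -ler_pdivrMr ?powR_gt0.
Qed.

(** With positive bounds [A] and [B] in place of the two norms, summing the convexity inequality
    over [i] is the whole proof: there is no p-th root and no case of a zero norm. *)
Lemma sum_powR_minkowski (I : finType) (w f g : I -> R) (p A B : R) :
  1 <= p -> 0 < A -> 0 < B ->
  (forall i, 0 <= w i) -> (forall i, 0 <= f i) -> (forall i, 0 <= g i) ->
  \sum_i w i * f i `^ p <= A `^ p -> \sum_i w i * g i `^ p <= B `^ p ->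
  \sum_i w i * (f i + g i) `^ p <= (A + B) `^ p.
Proof.
move=> p1 A0 B0 w0 f0 g0 hf hg; have AB0 : 0 < A + B by rewrite addr_gt0.
have Ap : 0 < A `^ p by rewrite powR_gt0.
have Bp : 0 < B `^ p by rewrite powR_gt0.
apply: (@le_trans _ _ (\sum_i (A + B) `^ p *
   (A / (A + B) / A `^ p * (w i * f i `^ p) + B / (A + B) / B `^ p * (w i * g i `^ p)))).
  apply: ler_sum => i _.
  apply: (le_trans (ler_wpM2l (w0 i) (powR_add_le p1 A0 B0 (f0 i) (g0 i)))).
  by rewrite le_eqVlt; apply/orP; left; apply/eqP; field; rewrite !gt_eqF.
rewrite -mulr_sumr -[leRHS]mulr1 ler_pM2l ?powR_gt0// big_split/= -!mulr_sumr.
apply: (@le_trans _ _ (A / (A + B) / A `^ p * A `^ p + B / (A + B) / B `^ p * B `^ p)).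
  by apply: lerD; rewrite ler_wpM2l// !divr_ge0// ltW.
by rewrite le_eqVlt; apply/orP; left; apply/eqP; field; rewrite !gt_eqF.
Qed.

Section gluing.
Variables (I : finType) (G M L : I -> I -> R) (u v : I -> R).
Hypothesis G0 : forall a b, 0 <= G a b.
Hypothesis M0 : forall a b, 0 <= M a b.
Hypothesis L0 : forall a b, 0 <= L a b.
Hypothesis Gu : forall a, \sum_b G a b <= u a.
Hypothesis Gv : forall b, \sum_a G a b <= v b.
Hypothesis Mu : forall a, \sum_a' M a a' <= u a.
Hypothesis Lv : forall b, \sum_b' L b b' <= v b.

(* Composition of the couplings M and L with the plan G; a cell of mass 0 has
   zero rows in M and L, so x / 0 = 0 is the right convention. *)
Definition glue (z : (I * I) * (I * I)) : R :=
  G z.1.1 z.2.1 * (M z.1.1 z.1.2 / u z.1.1) * (L z.2.1 z.2.2 / v z.2.1).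

Let u0 a : 0 <= u a. Proof. by apply: le_trans (Gu a); apply: sumr_ge0. Qed.
Let v0 a : 0 <= v a. Proof. by apply: le_trans (Gv a); apply: sumr_ge0. Qed.

Lemma glue_ge0 z : 0 <= glue z.
Proof. by rewrite /glue !mulr_ge0// invr_ge0. Qed.

Let div_mul_le (x y : R) : 0 <= x -> x / y * y <= x.
Proof. by move=> x0; have [->|y0] := eqVneq y 0; rewrite ?mulr0 ?divfK. Qed.

Let kM a : 0 <= \sum_a' (M a a' / u a) <= 1.
Proof.
rewrite -mulr_suml divr_ge0 ?sumr_ge0//=.
have [->|ua] := eqVneq (u a) 0; first by rewrite invr0 mulr0.
by rewrite ler_pdivrMr ?lt0r ?ua ?mul1r/=.
Qed.

Let kL b : 0 <= \sum_b' (L b b' / v b) <= 1.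
Proof.
rewrite -mulr_suml divr_ge0 ?sumr_ge0//=.
have [->|ua] := eqVneq (v b) 0; first by rewrite invr0 mulr0.
by rewrite ler_pdivrMr ?lt0r ?ua ?mul1r/=.
Qed.

(** [M a a' / u a] and [L b b' / v b] are subprobability kernels. Summing out b' and then b leaves
    at most [u a] from the row of [G], which cancels the normalisation of the first kernel. *)
Lemma glue_fst_le (f : I -> I -> R) : (forall a a', 0 <= f a a') ->
  \sum_z glue z * f z.1.1 z.1.2 <= \sum_a \sum_a' M a a' * f a a'.
Proof.
move=> f0; rewrite -(pair_bigA _ (fun x y => glue (x, y) * f x.1 x.2))/=.
rewrite [leRHS](pair_bigA _ (fun a a' => M a a' * f a a'))/=.
apply: ler_sum => -[a a'] _ /=.
rewrite -(pair_bigA _ (fun b b' => glue ((a, a'), (b, b')) * f a a'))/= /glue/=.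
apply: (@le_trans _ _ (\sum_b (M a a' / u a * f a a') * G a b)).
  apply: ler_sum => b _.
  rewrite (eq_bigr (fun b' => (M a a' / u a * f a a' * G a b) * (L b b' / v b))).
    rewrite -mulr_sumr -[leRHS]mulr1 ler_wpM2l ?(andP (kL b)).2//.
    by rewrite !mulr_ge0// invr_ge0.
  by move=> b' _; ring.
rewrite -mulr_sumr; apply: (@le_trans _ _ (M a a' / u a * f a a' * u a)).
  by rewrite ler_wpM2l// !mulr_ge0// invr_ge0.
by rewrite mulrAC ler_wpM2r// div_mul_le.
Qed.

Lemma glue_snd_le (f : I -> I -> R) : (forall b b', 0 <= f b b') ->
  \sum_z glue z * f z.2.1 z.2.2 <= \sum_b \sum_b' L b b' * f b b'.
Proof.
move=> f0; rewrite -(pair_bigA _ (fun x y => glue (x, y) * f y.1 y.2))/=.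
rewrite [leRHS](pair_bigA _ (fun a a' => L a a' * f a a'))/= exchange_big/=.
apply: ler_sum => -[b b'] _ /=.
rewrite -(pair_bigA _ (fun a a' => glue ((a, a'), (b, b')) * f b b'))/= /glue/=.
apply: (@le_trans _ _ (\sum_a (L b b' / v b * f b b') * G a b)).
  apply: ler_sum => a _.
  rewrite (eq_bigr (fun a' => (L b b' / v b * f b b' * G a b) * (M a a' / u a))).
    rewrite -mulr_sumr -[leRHS]mulr1 ler_wpM2l ?(andP (kM a)).2//.
    by rewrite !mulr_ge0// invr_ge0.
  by move=> a' _; ring.
rewrite -mulr_sumr; apply: (@le_trans _ _ (L b b' / v b * f b b' * v b)).
  by rewrite ler_wpM2l// !mulr_ge0// invr_ge0.
by rewrite mulrAC ler_wpM2r// div_mul_le.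
Qed.

Let glue_midE (f : I -> I -> R) : \sum_z glue z * f z.1.1 z.2.1 =
  \sum_a \sum_b G a b * f a b * (\sum_a' (M a a' / u a)) * (\sum_b' (L b b' / v b)).
Proof.
rewrite -(pair_bigA _ (fun x y => glue (x, y) * f x.1 y.1))/=.
rewrite -(pair_bigA _ (fun a a' => \sum_y glue ((a, a'), y) * f a y.1))/=.
apply: eq_bigr => a _.
rewrite (eq_bigr (fun a' => \sum_b \sum_b' glue ((a, a'), (b, b')) * f a b)); last first.
  by move=> a' _; rewrite (pair_bigA _ (fun b b' => glue ((a, a'), (b, b')) * f a b)).
rewrite exchange_big/=; apply: eq_bigr => b _.
rewrite [X in X * _]mulr_sumr mulr_suml; apply: eq_bigr => a' _.
by rewrite mulr_sumr; apply: eq_bigr => b' _; rewrite /glue/=; ring.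
Qed.

Lemma glue_mid_le (f : I -> I -> R) : (forall a b, 0 <= f a b) ->
  \sum_z glue z * f z.1.1 z.2.1 <= \sum_a \sum_b G a b * f a b.
Proof.
move=> f0; rewrite glue_midE; apply: ler_sum => a _; apply: ler_sum => b _.
rewrite -mulrA -[leRHS]mulr1 ler_wpM2l ?mulr_ge0//.
by have /andP[? ?] := kM a; have /andP[? ?] := kL b; rewrite mulr_ile1.
Qed.

(** Mass at (a, b) survives with the factor k a * l b, the product of the two kernel masses, and k *
    l >= 1 - (1 - k) - (1 - l). The loss charged to a is then at most u a * (1 - k a), which is
    exactly what [M] leaves unmatched there; likewise for b and [L]. *)
Lemma glue_mass_ge : \sum_a \sum_b G a b
    - (\sum_a u a - \sum_a \sum_a' M a a') - (\sum_b v b - \sum_b \sum_b' L b b')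
  <= \sum_z glue z.
Proof.
have -> : \sum_z glue z =
    \sum_a \sum_b G a b * 1 * (\sum_a' (M a a' / u a)) * (\sum_b' (L b b' / v b)).
  by rewrite -(glue_midE (fun _ _ => 1)); apply: eq_bigr => z _; rewrite mulr1.
pose k a := \sum_a' (M a a' / u a); pose l b := \sum_b' (L b b' / v b).
have hM a : u a * (1 - k a) = u a - \sum_a' M a a'.
  rewrite /k -mulr_suml mulrBr mulr1; have [ua|ua] := eqVneq (u a) 0.
    have := Mu a; rewrite ua => h; rewrite mul0r subr0.
    have -> : \sum_a' M a a' = 0 by apply/eqP; rewrite eq_le h sumr_ge0.
    by rewrite subr0.
  by rewrite mulrC divfK.
have hL a : v a * (1 - l a) = v a - \sum_a' L a a'.
  rewrite /l -mulr_suml mulrBr mulr1; have [ua|ua] := eqVneq (v a) 0.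
    have := Lv a; rewrite ua => h; rewrite mul0r subr0.
    have -> : \sum_a' L a a' = 0 by apply/eqP; rewrite eq_le h sumr_ge0.
    by rewrite subr0.
  by rewrite mulrC divfK.
apply: (@le_trans _ _ (\sum_a \sum_b G a b * (1 - (1 - k a) - (1 - l b)))); last first.
  apply: ler_sum => a _; apply: ler_sum => b _.
  rewrite mulr1 -mulrA ler_wpM2l// -/(k a) -/(l b).
  have /andP[_] := kM a; rewrite -/(k a) => ka.
  have /andP[_] := kL b; rewrite -/(l b) => lb.
  by have := mulr_ge0 (_ : 0 <= 1 - k a) (_ : 0 <= 1 - l b); nra.
have -> : \sum_a \sum_b G a b * (1 - (1 - k a) - (1 - l b)) =
   \sum_a \sum_b G a b - \sum_a \sum_b G a b * (1 - k a) - \sum_b \sum_a G a b * (1 - l b).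
  rewrite [X in _ - X]exchange_big/= -!sumrB; apply: eq_bigr => a _.
  by rewrite -!sumrB; apply: eq_bigr => b _; ring.
rewrite -[X in _ - X - _]sumrB -[X in _ - _ - X <= _]sumrB.
apply: lerB; [apply: lerB => //|]; apply: ler_sum => a _.
  by rewrite -mulr_suml -hM ler_wpM2r// subr_ge0 (andP (kM a)).2.
by rewrite -mulr_suml -hL ler_wpM2r// subr_ge0 (andP (kL a)).2.
Qed.

End gluing.
End finite_couplings.

(** * Greedy matching along a nested sequence of partitions *)

Section tree_matching.
Variables (R : realType) (I : finType).

Section one_level.
Variables (T : finType) (q : I -> T).
Implicit Types r s : I -> R.

Definition fiber_mass r t := \sum_(a | q a == t) r a.

(* Product coupling inside each fibre, normalised so that the smaller of the two
   masses is entirely matched. *)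
Definition level_match r s a b : R :=
  if q a == q b then
    r a * s b / Num.max (fiber_mass r (q a)) (fiber_mass s (q a)) else 0.

Lemma fiber_mass_ge0 r t : (forall a, 0 <= r a) -> 0 <= fiber_mass r t.
Proof. by move=> r0; apply: sumr_ge0. Qed.

Lemma sum_fiber_mass r : \sum_t fiber_mass r t = \sum_a r a.
Proof. by rewrite [RHS](partition_big q xpredT). Qed.

Lemma level_matchC r s a b : level_match r s a b = level_match s r b a.
Proof.
rewrite /level_match eq_sym; case: eqP => // ->.
by rewrite maxC [r a * _]mulrC.
Qed.

Lemma level_match_ge0 r s a b :
  (forall a, 0 <= r a) -> (forall a, 0 <= s a) -> 0 <= level_match r s a b.
Proof.
move=> r0 s0; rewrite /level_match; case: ifP => // _.
by rewrite divr_ge0 ?mulr_ge0// le_max fiber_mass_ge0.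
Qed.

Lemma level_match_rowE r s a : \sum_b level_match r s a b =
  r a * (fiber_mass s (q a) / Num.max (fiber_mass r (q a)) (fiber_mass s (q a))).
Proof.
rewrite mulrA /fiber_mass mulr_sumr mulr_suml [RHS]big_mkcond; apply: eq_bigr => b _.
by rewrite /level_match eq_sym; case: ifP.
Qed.

Lemma level_match_row_le r s a :
  (forall a, 0 <= r a) -> (forall a, 0 <= s a) ->
  \sum_b level_match r s a b <= r a.
Proof.
move=> r0 s0; rewrite level_match_rowE -[leRHS]mulr1 ler_wpM2l//.
set x := fiber_mass r _; set y := fiber_mass s _.
have x0 : 0 <= x by exact: fiber_mass_ge0.
have y0 : 0 <= y by exact: fiber_mass_ge0.
have [m0|m0] := eqVneq (Num.max x y) 0; first by rewrite m0 invr0 mulr0.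
by rewrite ler_pdivrMr ?mul1r ?lt0r ?m0 le_max ?x0 ?lexx ?orbT.
Qed.

(** Normalising by the maximum keeps the same fraction of every cell of a fibre, so the fibre
    retains exactly its positive excess. This closed form makes the residuals of the whole recursion
    computable. *)
Lemma level_match_residual r s t :
  (forall a, 0 <= r a) -> (forall a, 0 <= s a) ->
  fiber_mass (fun a => r a - \sum_b level_match r s a b) t =
  Num.max 0 (fiber_mass r t - fiber_mass s t).
Proof.
move=> r0 s0; set x := fiber_mass r t; set y := fiber_mass s t.
have x0 : 0 <= x by exact: fiber_mass_ge0.
have y0 : 0 <= y by exact: fiber_mass_ge0.
rewrite /fiber_mass sumrB -/(fiber_mass r t) -/x.
rewrite (eq_bigr (fun a => r a * (y / Num.max x y))); last first.
  by move=> a /eqP qa; rewrite level_match_rowE qa.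
rewrite -mulr_suml -/(fiber_mass r t) -/x.
have [xy|yx] := leP x y.
  rewrite max_l ?subr_le0//; have [y00|y00] := eqVneq y 0.
    by rewrite y00 mul0r mulr0 subr0; apply/eqP; rewrite eq_le x0 -y00 xy.
  by rewrite divff// mulr1 subrr.
rewrite max_r ?subr_ge0 ?ltW// mulrC divfK// gt_eqF//.
exact: le_lt_trans yx.
Qed.

End one_level.

Variables (T : nat -> finType) (q : forall j, I -> T j) (u v : I -> R).
Hypothesis nested : forall j a b, q j.+1 a = q j.+1 b -> q j a = q j b.
Hypothesis u0 : forall a, 0 <= u a.
Hypothesis v0 : forall a, 0 <= v a.

(** For [u] and [v] of equal total mass, this is the total variation distance between their images
    at level [j]. *)
Definition level_excess j : R :=
  \sum_t Num.max 0 (fiber_mass (@q j) u t - fiber_mass (@q j) v t).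

Let resu (M : I -> I -> R) a := u a - \sum_b M a b.
Let resv (M : I -> I -> R) b := v b - \sum_a M a b.

(** The matching runs from fine to coarse, so the induction fixes [J] and lowers [j]. The support
    clause is what allows the residuals to be recomputed on the coarser fibres of the next step. *)
Let invariant (M : I -> I -> R) j J : Prop :=
  [/\ forall a b, 0 <= M a b,
      (forall a, 0 <= resu M a) /\ (forall b, 0 <= resv M b),
      (forall a b, q j a != q j b -> M a b = 0),
      (forall t, fiber_mass (@q j) (resu M) t =
         Num.max 0 (fiber_mass (@q j) u t - fiber_mass (@q j) v t)) &
      forall (c : I -> I -> R) (C : nat -> R),
        (forall j a b, q j a = q j b -> c a b <= C j) ->
        (forall j, 0 <= C j) ->
        \sum_a \sum_b M a b * c a b <=
          C J * \sum_a u a + \sum_(j <= i < J) C i * level_excess i.+1].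

Let level_cost j r s (c : I -> I -> R) (C : R) :
  (forall a, 0 <= r a) -> (forall a, 0 <= s a) -> 0 <= C ->
  (forall a b, q j a = q j b -> c a b <= C) ->
  \sum_a \sum_b level_match (@q j) r s a b * c a b <= C * \sum_a r a.
Proof.
move=> r0 s0 C0 cC; rewrite mulr_sumr; apply: ler_sum => a _.
apply: (@le_trans _ _ (\sum_b level_match (@q j) r s a b * C)).
  apply: ler_sum => b _; rewrite /level_match; case: eqP => [qab|_].
    apply: ler_wpM2l; last exact: cC.
    by rewrite divr_ge0 ?mulr_ge0// le_max fiber_mass_ge0.
  by rewrite !mul0r.
by rewrite -mulr_suml mulrC ler_wpM2l// level_match_row_le.
Qed.

Let invariant_exists m : forall j, exists M, invariant M j (j + m).
Proof.
elim: m => [|m IHm] j.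
  pose M a b := level_match (@q j) u v a b.
  exists M; split.
  - by move=> a b; exact: level_match_ge0.
  - split=> a; rewrite subr_ge0; first exact: level_match_row_le.
    rewrite (eq_bigr (level_match (@q j) v u a)); first exact: level_match_row_le.
    by move=> b _; rewrite /M level_matchC.
  - by move=> a b /negbTE qab; rewrite /M /level_match qab.
  - by move=> t; exact: level_match_residual.
  - move=> c C cC C0; rewrite addn0 big_geq// addr0.
    by apply: level_cost => // a b; exact: cC.
have [M [M0 [ru0 rv0] Msupp Mres Mcost]] := IHm j.+1.
have Msupp' a b : q j a != q j b -> M a b = 0.
  by move=> qab; apply: Msupp; apply: contra_neq qab; exact: nested.
pose N a b := level_match (@q j) (resu M) (resv M) a b.
have NrE a : \sum_b (M a b + N a b) = \sum_b M a b + \sum_b N a b.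
  by rewrite big_split.
have NcE b : \sum_a (M a b + N a b) =
    \sum_a M a b + \sum_a level_match (@q j) (resv M) (resu M) b a.
  by rewrite big_split; congr (_ + _); apply: eq_bigr => a _; exact: level_matchC.
exists (fun a b => M a b + N a b); split.
- by move=> a b; rewrite addr_ge0// level_match_ge0.
- split=> a; rewrite /resu /resv.
    by rewrite NrE opprD addrA subr_ge0; exact: level_match_row_le.
  by rewrite NcE opprD addrA subr_ge0; exact: level_match_row_le.
- by move=> a b qab; rewrite Msupp'// /N /level_match (negbTE qab) addr0.
- move=> t; transitivity (fiber_mass (@q j)
      (fun a => resu M a - \sum_b level_match (@q j) (resu M) (resv M) a b) t).
    by apply: eq_bigr => a _; rewrite /resu NrE opprD addrA.
  rewrite level_match_residual//; congr (Num.max _ _).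
  rewrite /fiber_mass /resu /resv !sumrB.
  (* The matching made at finer levels stays inside the fibres of level [j], so it removes equal
     masses from both sides of a fibre and the difference of the residuals is still that of [u] and
     [v]. *)
  suff -> : \sum_(a | q j a == t) \sum_b M a b = \sum_(b | q j b == t) \sum_a M a b.
    by ring.
  rewrite [RHS]exchange_big/= big_mkcond; apply: eq_bigr => a _; rewrite [RHS]big_mkcond.
  case: eqP => [qat|/eqP qat]; first (apply: eq_bigr => b _; case: eqP => // /eqP qbt).
    by rewrite Msupp'// qat eq_sym.
  by rewrite big1// => b _; case: eqP => // qbt; rewrite Msupp'// qbt.
- move=> c C cC C0; rewrite big_ltn; last by rewrite addnS leq_addr.
  rewrite -addSnnS [leRHS]addrCA [leRHS]addrC.
  rewrite (eq_bigr (fun a => \sum_b M a b * c a b + \sum_b N a b * c a b)); last first.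
    by move=> a _; rewrite -big_split; apply: eq_bigr => b _; rewrite mulrDl.
  rewrite big_split/=; apply: lerD; first exact: Mcost.
  apply: (le_trans (level_cost _ _ (C0 j) _)) => //; first by move=> a b; exact: cC.
  rewrite -(sum_fiber_mass (@q j.+1)) /level_excess.
  by under eq_bigr do rewrite Mres.
Qed.

Lemma tree_matching j0 J : (j0 <= J)%N -> exists M : I -> I -> R,
  [/\ forall a b, 0 <= M a b,
      forall a, \sum_b M a b <= u a,
      forall b, \sum_a M a b <= v b,
      \sum_a \sum_b M a b = \sum_a u a - level_excess j0 &
      forall (c : I -> I -> R) (C : nat -> R),
        (forall j a b, q j a = q j b -> c a b <= C j) ->
        (forall j, 0 <= C j) ->
        \sum_a \sum_b M a b * c a b <=
          C J * \sum_a u a + \sum_(j0 <= i < J) C i * level_excess i.+1].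
Proof.
move=> /subnKC <-; have [M [M0 [ru0 rv0] _ Mres Mcost]] := invariant_exists (J - j0) j0.
exists M; split=> //.
- by move=> a; rewrite -subr_ge0; exact: ru0.
- by move=> b; rewrite -subr_ge0; exact: rv0.
- suff -> : level_excess j0 = \sum_a resu M a by rewrite /resu sumrB; ring.
  by rewrite -(sum_fiber_mass (@q j0)); apply: eq_bigr => t _; rewrite Mres.
Qed.

End tree_matching.

(** * Union bound and Chernoff's inequality *)

Section concentration.
Context (R : realType) (dO : measure_display) (O : measurableType dO).

Lemma measure_fin_bigcup_le (mu : {measure set O -> \bar R}) (I : finType)
    (D : pred I) (F : I -> set O) : (forall i, measurable (F i)) ->
  (mu (\bigcup_(i in [set i | D i]) F i) <= \sum_(i | D i) mu (F i))%E.
Proof.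
move=> mF.
have -> : \bigcup_(i in [set i | D i]) F i = \big[setU/set0]_(i | D i) F i.
  rewrite -bigcup_seq_cond; congr bigcup.
  by apply/seteqP; split=> i /=; rewrite mem_index_enum.
suff [] : measurable (\big[setU/set0]_(i | D i) F i) /\
   (mu (\big[setU/set0]_(i | D i) F i) <= \sum_(i | D i) mu (F i))%E by [].
apply: (big_rec2 (fun (A : set O) (x : \bar R) => measurable A /\ (mu A <= x)%E)).
  by rewrite measure0.
move=> i x A _ [mA Ax]; split; first exact: measurableU.
by apply: le_trans (measureU2 mu (mF i) mA) _; rewrite leeD2l.
Qed.

(** Inverting 1 + l <= e ^ l avoids any Taylor remainder and any smallness condition on [l]. *)
Lemma expRN_le_quad (l : R) : 0 <= l -> expR (- l) <= 1 - l + l ^+ 2.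
Proof.
move=> l0; have l1 : 0 < 1 + l by lra.
rewrite expRN; apply: (@le_trans _ _ (1 + l)^-1).
  by rewrite lef_pV2 ?posrE ?expR_gt0// expR_ge1Dx.
rewrite -[_^-1]mul1r ler_pdivrMr//.
have -> : (1 - l + l ^+ 2) * (1 + l) = 1 + l ^+ 3 by ring.
by rewrite lerDl exprn_ge0.
Qed.

(** Independence enters as a product formula for every pattern [f] of hits and misses. The event is
    a finite union of such patterns, so the moment generating function is a finite sum over patterns
    that factorises over the indices; no expectation is integrated. *)
Lemma bernoulli_lower_tail (P : probability O R) (n : nat) (F : 'I_n -> set O)
    (q s : R) : (forall i, measurable (F i)) -> 0 <= q <= 1 -> 0 <= s ->
  (forall f : {ffun 'I_n -> bool},
     fine (P (\bigcap_i (if f i then F i else ~` F i))) =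
     \prod_i (if f i then q else 1 - q)) ->
  let B := [set w | \sum_i (w \in F i)%:R <= n%:R * (q - s)] in
  measurable B /\ (P B <= (expR (- (n%:R * s ^+ 2 / 4)))%:E)%E.
Proof.
move=> mF /andP[q0 q1] s0 indep B.
pose pat (f : {ffun 'I_n -> bool}) := \bigcap_i (if f i then F i else ~` F i).
have mpat f : measurable (pat f).
  apply: (fin_bigcap_measurable finite_finset) => i _; case: ifP => // _; exact: measurableC.
pose D (f : {ffun 'I_n -> bool}) := \sum_i (f i)%:R <= n%:R * (q - s).
have BE : B = \bigcup_(f in [set f | D f]) pat f.
  apply/seteqP; split => w /=.
    move=> Bw; exists [ffun i => w \in F i]; rewrite /D /=.
      by under eq_bigr do rewrite ffunE.
    move=> i _ /=; rewrite ffunE; case: ifPn; first by rewrite inE.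
    by rewrite notin_setE.
  move=> [f Df pf]; rewrite /B /=; apply: le_trans Df.
  apply: ler_sum => i _; have := pf i Logic.I; case: (f i) => /=.
    by rewrite lern1; case: (_ \in _).
  by move=> h; rewrite memNset.
split; first by rewrite BE; apply: (fin_bigcup_measurable finite_finset).
pose l := s / 2; have l0 : 0 <= l by rewrite /l divr_ge0.
rewrite BE; apply: le_trans (measure_fin_bigcup_le _ _ mpat) _.
have patE f : P (pat f) = (\prod_i (if f i then q else 1 - q))%:E.
  by rewrite -indep fineK//; apply: fin_num_measure; exact: mpat.
rewrite (eq_bigr _ (fun f _ => patE f)).
rewrite sumEFin lee_fin.
have w0 (f : {ffun 'I_n -> bool}) : 0 <= \prod_i (if f i then q else 1 - q).
  by apply: prodr_ge0 => i _; case: ifP => // _; rewrite subr_ge0.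
(* Exponential Markov inequality, with the parameter l optimised to s / 2. *)
apply: (@le_trans _ _ (\sum_(f : {ffun 'I_n -> bool})
   expR (l * (n%:R * (q - s) - \sum_i (f i)%:R)) * \prod_i (if f i then q else 1 - q))).
  rewrite [leLHS]big_mkcond/=; apply: ler_sum => f _; case: ifP => [Df|_].
    rewrite -[leLHS]mul1r ler_wpM2r//.
    apply: le_trans (expR_ge1Dx _); rewrite lerDl mulr_ge0// subr_ge0.
    exact: Df.
  by rewrite mulr_ge0// expR_ge0.
rewrite (eq_bigr (fun f : {ffun 'I_n -> bool} => expR (l * (n%:R * (q - s))) *
    \prod_i (fun b : bool => if b then expR (- l) * q else 1 - q) (f i))); last first.
  move=> f _; rewrite mulrBr expRD -mulrA; congr (_ * _).
  rewrite mulr_sumr -sumrN expR_sum -big_split/=; apply: eq_bigr => i _.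
  by case: (f i); rewrite ?mulr1 ?mulr0 ?oppr0 ?expR0 ?mul1r.
rewrite -mulr_sumr -(bigA_distr_bigA (fun (i : 'I_n) (b : bool) =>
   if b then expR (- l) * q else 1 - q)).
rewrite (eq_bigr (fun=> expR (- l) * q + (1 - q))); last first.
  by move=> i _; rewrite big_bool/=.
rewrite prodr_const card_ord.
(* As q <= 1, each factor 1 - q + q * e ^ (- l) is at most 1 - l * q + l ^ 2, hence at most e ^ (- l
   * q + l ^ 2). With l = s / 2 the exponents add up to - n * s ^ 2 / 4. *)
apply: (@le_trans _ _ (expR (l * (n%:R * (q - s))) * expR (- l * q + l ^+ 2) ^+ n)).
  rewrite ler_wpM2l ?expR_ge0// lerXn2r ?nnegrE ?expR_ge0//.
    by rewrite addr_ge0 ?mulr_ge0 ?expR_ge0 ?subr_ge0.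
  apply: le_trans (expR_ge1Dx _).
  by have := expRN_le_quad l0; have := sqr_ge0 l; nra.
rewrite -expRM_natl -expRD ler_expR /l.
by rewrite le_eqVlt; apply/orP; left; apply/eqP; field.
Qed.

End concentration.

(** * Euclidean distance: triangle inequality and measurability *)

Section euclidean_distance.
Variables (R : realType) (d : nat).
Implicit Types x y z : 'rV[R]_d.

Lemma eucl_dist_ge0 x y : 0 <= eucl_dist x y.
Proof. exact: sqrtr_ge0. Qed.

Lemma eucl_distC x y : eucl_dist x y = eucl_dist y x.
Proof. by congr Num.sqrt; apply: eq_bigr => i _; rewrite -sqrrN opprB. Qed.

Lemma sqr_eucl_dist x y :
  eucl_dist x y ^+ 2 = \sum_(i < d) (x ord0 i - y ord0 i) ^+ 2.
Proof. by rewrite sqr_sqrtr// sumr_ge0// => i _; rewrite sqr_ge0. Qed.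

Lemma eucl_dist_le x y (m : R) : 0 <= m ->
  \sum_(i < d) (x ord0 i - y ord0 i) ^+ 2 <= m ^+ 2 -> eucl_dist x y <= m.
Proof.
by move=> m0 h; rewrite -[leRHS](ger0_norm m0) -sqrtr_sqr ler_sqrt ?sqr_ge0.
Qed.

Lemma eucl_dist_triangle x y z :
  eucl_dist x z <= eucl_dist x y + eucl_dist y z.
Proof.
(* The slack e makes both bounds in Minkowski's inequality positive even when some of the points
   coincide. *)
apply/ler_addgt0Pr => e e0.
have e2 : 0 < e / 2 by rewrite divr_gt0.
pose A := eucl_dist x y + e / 2; pose B := eucl_dist y z + e / 2.
have A0 : 0 < A by rewrite ltr_wpDl// eucl_dist_ge0.
have B0 : 0 < B by rewrite ltr_wpDl// eucl_dist_ge0.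
have -> : eucl_dist x y + eucl_dist y z + e = A + B by rewrite /A /B; field.
apply: eucl_dist_le; first by rewrite addr_ge0// ltW.
have hA (a b : 'rV[R]_d) : \sum_(i < d) 1 * `|a ord0 i - b ord0 i| `^ 2%:R
    <= (eucl_dist a b + e / 2) `^ 2%:R.
  rewrite powR_mulrn; last by rewrite addr_ge0 ?eucl_dist_ge0// ltW.
  under eq_bigr do rewrite mul1r powR_mulrn// real_normK ?num_real//.
  by rewrite -sqr_eucl_dist lerXn2r ?nnegrE ?addr_ge0 ?eucl_dist_ge0 ?lerDl// ltW.
have := @sum_powR_minkowski R 'I_d (fun=> 1) (fun i => `|x ord0 i - y ord0 i|)
  (fun i => `|y ord0 i - z ord0 i|) 2%:R A B.
rewrite ler1n => /(_ isT A0 B0 _ _ _ (hA x y) (hA y z)) h.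
rewrite -powR_mulrn; last by rewrite addr_ge0// ltW.
apply: le_trans (h _ _ _) => //; apply: ler_sum => i _.
rewrite mul1r powR_mulrn ?addr_ge0// -[leLHS]real_normK ?num_real//.
rewrite lerXn2r ?nnegrE ?addr_ge0//.
have -> : x ord0 i - z ord0 i = (x ord0 i - y ord0 i) + (y ord0 i - z ord0 i) by ring.
exact: ler_normD.
Qed.

Lemma eucl_dist_le_coord x y (m : R) : 0 <= m ->
  (forall i, `|x ord0 i - y ord0 i| <= m) -> eucl_dist x y <= d%:R * m.
Proof.
move=> m0 h; apply: eucl_dist_le; first by rewrite mulr_ge0.
apply: (@le_trans _ _ (\sum_(i < d) m ^+ 2)).
  by apply: ler_sum => i _; rewrite -[leLHS]real_normK ?num_real// lerXn2r ?nnegrE.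
rewrite sumr_const card_ord exprMn -[_ *+ d]mulr_natl ler_wpM2r ?sqr_ge0//.
by rewrite -natrX ler_nat; case: d => // n; rewrite expnS leq_pmulr.
Qed.

Lemma coord_le_eucl_dist x y i : `|x ord0 i - y ord0 i| <= eucl_dist x y.
Proof.
rewrite -sqrtr_sqr ler_sqrt; last by rewrite sumr_ge0// => j _; rewrite sqr_ge0.
by rewrite (bigD1 i)//= lerDl sumr_ge0// => j _; rewrite sqr_ge0.
Qed.

Lemma compact_measurable_Rd (K : set 'rV[R]_d) :
  compact K -> measurable (K : set (Rd R d)).
Proof.
move=> cK; have : closed K by apply: compact_closed => //.
move=> /closed_openC oK; rewrite -(setCK K).
by apply: (@measurableC _ (Rd R d)); apply: sub_sigma_algebra.
Qed.

Lemma measurable_coord i : measurable_fun setT (fun x : Rd R d => x ord0 i : R).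
Proof.
apply: (measurability _ (RGenOpens.measurableE R)).
move=> _ [_ [a [b ->] <-]]; rewrite setTI; apply: sub_sigma_algebra => /=.
have /continuousP := @coord_continuous R 1 d ord0 i.
by apply; exact: interval_open.
Qed.

Lemma measurable_eucl_dist (p : R) :
  measurable_fun setT (fun z : Rd R d * Rd R d => (eucl_dist z.1 z.2 `^ p)%:E).
Proof.
apply/measurable_EFinP.
apply: (@measurableT_comp _ _ _ _ _ _ (@powR R ^~ p)) => //.
rewrite /eucl_dist; apply: (@measurableT_comp _ _ _ _ _ _ (@Num.sqrt R)).
  by apply: continuous_measurable_fun; exact: sqrt_continuous.
apply: measurable_sum => i; apply: measurable_funX; apply: measurable_funB.
  by apply: (@measurableT_comp _ _ _ _ _ _ (fun x : Rd R d => x ord0 i));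
    [exact: measurable_coord|exact: measurable_fst].
by apply: (@measurableT_comp _ _ _ _ _ _ (fun x : Rd R d => x ord0 i));
  [exact: measurable_coord|exact: measurable_snd].
Qed.

End euclidean_distance.

(** * Finite combinations and restrictions of measures *)

Section measure_constructions.
Context (R : realType) (dT : measure_display) (T : measurableType dT).

(** Builds both the transferred plan, as a combination of restricted product measures, and the
    empirical measure, as a combination of Dirac masses. *)
Lemma weighted_measure_sum (I : finType) (w : I -> R)
    (m : I -> {measure set T -> \bar R}) : (forall i, 0 <= w i) ->
  exists M : {measure set T -> \bar R},
    (forall A, M A = \sum_i (w i)%:E * m i A)%E /\
    (forall f : T -> \bar R, (forall x, 0 <= f x)%E -> measurable_fun [set: T] f ->
      (\int[M]_x f x = \sum_i (w i)%:E * \int[m i]_x f x)%E).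
Proof.
move=> w0; elim: (index_enum I) => [|i s [M [ME Mint]]].
  exists mzero; split=> [A|f f0 mf]; rewrite big_nil//.
  exact: integral_measure_zero.
exists (measure_add (mscale (NngNum (w0 i)) (m i)) M); split=> [A|f f0 mf].
  by rewrite big_cons -ME; exact: measure_addE.
by rewrite big_cons ge0_integral_measure_add// ge0_integral_mscale// Mint.
Qed.

Lemma measure_disjoint_bigcup (m : {measure set T -> \bar R}) (I : finType)
    (F : I -> set T) : (forall i, measurable (F i)) -> trivIset setT F ->
  m (\bigcup_i F i) = (\sum_i m (F i))%E.
Proof.
move=> mF tF; rewrite (measure_fin_bigcup m finite_finset)//.
rewrite -[RHS]big_enum /= [RHS]fsbig_seq ?enum_uniq//.
suff -> : [set` enum I] = setT by [].
by apply/seteqP; split=> i //= _; rewrite mem_enum.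
Qed.

Lemma sum_measure_disjoint_le (m : {measure set T -> \bar R}) (I : finType)
    (F : I -> set T) (A : set T) :
  (forall i, measurable (F i)) -> measurable A -> trivIset setT F ->
  (forall i, F i `<=` A) -> (\sum_i m (F i) <= m A)%E.
Proof.
move=> mF mA tF FA; rewrite -measure_disjoint_bigcup//.
apply: le_measure; rewrite ?inE//; last by apply: bigcup_sub => i _.
exact: (fin_bigcup_measurable finite_finset).
Qed.

Lemma integral_mrestr_le (m : {measure set T -> \bar R}) (D : set T)
    (mD : measurable D) (f : T -> \bar R) (c : R) : 0 <= c ->
  (forall x, 0 <= f x)%E -> measurable_fun [set: T] f ->
  (forall x, D x -> f x <= c%:E)%E ->
  (\int[mrestr m mD]_x f x <= c%:E * m D)%E.
Proof.
move=> c0 f0 mf fc.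
rewrite -(setUv D) ge0_integral_setU//; [|exact: measurableC|by rewrite setUv|].
  rewrite [X in (_ + X)%E]null_set_integral.
  - rewrite adde0; apply: (@le_trans _ _ (\int[mrestr m mD]_(x in D) c%:E)%E).
      apply: ge0_le_integral => //; exact: measurable_funTS.
    by rewrite integral_cst//= /mrestr setIid.
  - exact: measurableC.
  - exact: measurable_funTS.
  - by rewrite /= /mrestr setICl measure0.
by apply/disj_setPRL.
Qed.

(** Normalising a measure of mass 1 does not change it; [P0] is the fallback value that [mnormalize]
    takes for degenerate masses. *)
Lemma unit_mass_probability (m : {measure set T -> \bar R}) (P0 : probability T R) :
  m setT = 1%E -> exists P : probability T R, (P : set T -> \bar R) = m.
Proof.
move=> m1; exists (mnormalize m P0); apply/funext => A /=.
by rewrite /mnormalize m1 onee_eq0/= invr1 mule1.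
Qed.

End measure_constructions.

(** * Transferring a partial plan along couplings of its marginals *)

Section transfer.
Variables (R : realType) (d : nat) (I : finType).
Variables (Q : I -> set (Rd R d)) (z : I -> 'rV[R]_d) (h p : R).
Hypothesis mQ : forall a, measurable (Q a).
Hypothesis tQ : trivIset setT Q.
Hypothesis Qz : forall a x, Q a x -> eucl_dist x (z a) <= h.
Hypothesis h0 : 0 <= h.
Hypothesis p1 : 1 <= p.

Let p0 : 0 <= p. Proof. exact: le_trans p1. Qed.

Definition cell_mass (mu : set (Rd R d) -> \bar R) a : R := fine (mu (Q a)).

Definition cell_dist a b : R := eucl_dist (z a) (z b) + 2 * h.

(** Only cell masses enter: an entry of [M] stands for mass spread over a block as a product
    measure. [s] bounds the unmatched part of a total mass 1, and the cost is kept as a p-th power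
    so that no root is taken. *)
Definition cell_coupling (mu mu' : set (Rd R d) -> \bar R) (s B : R) :=
  exists M : I -> I -> R,
    [/\ forall a b, 0 <= M a b,
        forall a, \sum_b M a b <= cell_mass mu a,
        forall b, \sum_a M a b <= cell_mass mu' b,
        1 - s <= \sum_a \sum_b M a b &
        \sum_a \sum_b M a b * cell_dist a b `^ p <= B `^ p].

Lemma cell_coupling_sym mu mu' s B :
  cell_coupling mu mu' s B -> cell_coupling mu' mu s B.
Proof.
move=> [M [M0 Mr Mc Ms MB]]; exists (fun a b => M b a); split=> //.
  by rewrite exchange_big.
rewrite exchange_big/=; apply: le_trans MB; apply: ler_sum => a _.
by apply: ler_sum => b _; rewrite /cell_dist eucl_distC.
Qed.

Let cell_mass_ge0 (mu : probability (Rd R d) R) a : 0 <= cell_mass mu a.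
Proof. exact/fine_ge0. Qed.

Let cell_massE (mu : probability (Rd R d) R) a : mu (Q a) = (cell_mass mu a)%:E.
Proof. by rewrite fineK// fin_num_measure. Qed.

Let mQQ a b : measurable (Q a `*` Q b). Proof. exact: measurableX. Qed.

Definition discrete_plan (gamma : set (Rd R d * Rd R d)%type -> \bar R) a b : R :=
  fine (gamma (Q a `*` Q b)).

Section discretization.
Variables (mu nu : probability (Rd R d) R) (alpha : R).
Variable gamma : {measure set (Rd R d * Rd R d)%type -> \bar R}.
Hypothesis plan : partial_plan mu nu alpha gamma.
Hypothesis mu1 : \sum_a cell_mass mu a = 1.
Hypothesis nu1 : \sum_a cell_mass nu a = 1.

Local Notation G := (discrete_plan gamma).

Let gamma_fin A : measurable A -> gamma A \is a fin_num.
Proof.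
move=> mA; rewrite ge0_fin_numE//; apply: (@le_lt_trans _ _ (gamma setT)).
  by apply: le_measure; rewrite ?inE.
by rewrite plan.1 ltry.
Qed.

Let GE a b : gamma (Q a `*` Q b) = (G a b)%:E.
Proof. by rewrite fineK// gamma_fin. Qed.

Lemma discrete_plan_ge0 a b : 0 <= G a b. Proof. exact/fine_ge0. Qed.

Lemma discrete_plan_row a : \sum_b G a b <= cell_mass mu a.
Proof.
rewrite -lee_fin -cell_massE -sumEFin -(eq_bigr _ (fun b _ => GE a b)).
apply: le_trans (plan.2 _ (mQ a)).1.
apply: sum_measure_disjoint_le => //; first exact: measurableX.
  apply/trivIsetP => i j _ _ ij; apply/seteqP; split=> // -[x y] /= [[_ qi] [_ qj]].
  by move/trivIsetP: tQ => /(_ i j Logic.I Logic.I ij); rewrite predeqE => /(_ y)[+ _]; apply.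
by move=> i -[x y] /= [].
Qed.

Lemma discrete_plan_col b : \sum_a G a b <= cell_mass nu b.
Proof.
rewrite -lee_fin -cell_massE -sumEFin -(eq_bigr _ (fun a _ => GE a b)).
apply: le_trans (plan.2 _ (mQ b)).2.
apply: (@sum_measure_disjoint_le _ _ _ gamma _ (fun a => Q a `*` Q b)) => //.
- exact: measurableX.
- apply/trivIsetP => i j _ _ ij; apply/seteqP; split=> // -[x y] /= [[qi _] [qj _]].
  by move/trivIsetP: tQ => /(_ i j Logic.I Logic.I ij); rewrite predeqE => /(_ x)[+ _]; apply.
- by move=> i -[x y] /= [].
Qed.

Let N : set (Rd R d) := ~` (\bigcup_a Q a).

Let mN : measurable N.
Proof. by apply: measurableC; apply: (fin_bigcup_measurable finite_finset). Qed.

Let null_outside (m : probability (Rd R d) R) :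
  \sum_a cell_mass m a = 1 -> m N = 0%E.
Proof.
move=> m1; rewrite /N probability_setC; last first.
  exact: (fin_bigcup_measurable finite_finset).
rewrite measure_disjoint_bigcup// (eq_bigr _ (fun a _ => cell_massE m a)) sumEFin m1.
by rewrite -EFinB subrr.
Qed.

(** The cells carry all of mu and nu. Domination of the marginals then makes both [N * setT] and
    [setT * N] null for gamma, so the blocks lose none of its mass. *)
Lemma discrete_plan_mass : alpha <= \sum_a \sum_b G a b.
Proof.
rewrite -lee_fin -plan.1.
have cov : setT `<=` (\bigcup_(i in [set i : I * I | true]) (Q i.1 `*` Q i.2)) `|`
    ((N `*` setT) `|` (setT `*` N)).
  move=> -[x y] _; have [Nx|] := pselect (N x); first by right; left.
  have [Ny|] := pselect (N y); first by right; right.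
  by move=> /contrapT[b _ Qb] /contrapT[a _ Qa]; left; exists (a, b).
have mcov : measurable (\bigcup_(i in [set i : I * I | true]) (Q i.1 `*` Q i.2)).
  by apply: (fin_bigcup_measurable finite_finset).
have mNT : measurable (N `*` [set: Rd R d]) by exact: measurableX.
have mTN : measurable ([set: Rd R d] `*` N) by exact: measurableX.
apply: (@le_trans _ _ (gamma ((\bigcup_(i in [set i : I * I | true]) (Q i.1 `*` Q i.2)) `|`
    ((N `*` setT) `|` (setT `*` N))))).
  by apply: le_measure => //; rewrite inE//; apply: measurableU => //; exact: measurableU.
apply: (le_trans (measureU2 gamma mcov (measurableU _ _ mNT mTN))).
rewrite -[leRHS]adde0; apply: leeD.
  apply: le_trans (measure_fin_bigcup_le _ _ _) _ => //.
  rewrite pair_big/= -sumEFin le_eqVlt; apply/orP; left; apply/eqP.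
  by apply: eq_bigr => -[a b] _; exact: GE.
apply: (le_trans (measureU2 gamma mNT mTN)); rewrite -[leRHS]add0e; apply: leeD.
  by rewrite -(null_outside mu1); exact: (plan.2 _ mN).1.
by rewrite -(null_outside nu1); exact: (plan.2 _ mN).2.
Qed.

(** A lower bound for the distance between two cells, so that the discretised plan costs no more
    than gamma. The deficit 2 * h is charged to the couplings, through [cell_dist]. *)
Definition cell_gap a b : R := Num.max 0 (eucl_dist (z a) (z b) - 2 * h).

Lemma cell_gap_le_eucl_dist a b x y :
  Q a x -> Q b y -> cell_gap a b <= eucl_dist x y.
Proof.
move=> Qx Qy; rewrite /cell_gap ge_max eucl_dist_ge0/=.
have := eucl_dist_triangle (z a) x (z b); have := eucl_dist_triangle x y (z b).
have := Qz Qx; have := Qz Qy; rewrite [eucl_dist x (z a)]eucl_distC; lra.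
Qed.

Lemma discrete_plan_cost :
  ((\sum_a \sum_b G a b * cell_gap a b `^ p)%:E <=
   \int[gamma]_x ((eucl_dist x.1 x.2) `^ p)%:E)%E.
Proof.
pose f (i : I * I) (x : Rd R d * Rd R d) : \bar R :=
  ((cell_gap i.1 i.2 `^ p)%:E * (\1_(Q i.1 `*` Q i.2) x)%:E)%E.
have f0 i x : (0 <= f i x)%E by rewrite mule_ge0// lee_fin ?powR_ge0.
have mf i : measurable_fun setT (f i).
  apply: measurable_funeM; apply/measurable_EFinP; exact: measurable_indic.
have -> : (\sum_a \sum_b G a b * cell_gap a b `^ p)%:E =
    (\int[gamma]_x (\sum_i f i x))%E.
  rewrite ge0_integral_sum// pair_big/= -sumEFin; apply: eq_bigr => -[a b] _ /=.
  rewrite /f ge0_integralZl//=; last by rewrite lee_fin powR_ge0.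
    by rewrite integral_indic// setIT GE -EFinM mulrC.
  by apply/measurable_EFinP; exact: measurable_indic.
apply: ge0_le_integral => //.
- by move=> x _; apply: sume_ge0.
- by apply: emeasurable_sum => i.
- exact: measurable_eucl_dist.
- move=> [x y] _ /=.
  have [[[a b] [/= Qa Qb]]|nQ] := pselect (exists i : I * I, Q i.1 x /\ Q i.2 y).
    rewrite (bigD1 (a, b))//= big1 ?adde0.
      rewrite /f /= indicE mem_set// mule1 lee_fin ge0_ler_powR// ?nnegrE.
      - by rewrite le_max lexx.
      - exact: eucl_dist_ge0.
      - exact: cell_gap_le_eucl_dist.
    move=> [a' b'] ne; rewrite /f/= indicE memNset ?mule0//= => -[Qa' Qb'].
    move/trivIsetP: tQ => disj; move: ne; rewrite xpair_eqE negb_and => /orP[ne|ne].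
      by have := disj _ _ Logic.I Logic.I ne; rewrite predeqE => /(_ x)[+ _]; apply.
    by have := disj _ _ Logic.I Logic.I ne; rewrite predeqE => /(_ y)[+ _]; apply.
  rewrite big1 ?lee_fin ?powR_ge0// => i _.
  by rewrite /f indicE memNset ?mule0//= => -[? ?]; apply: nQ; exists i.
Qed.

End discretization.

(** The path from x to y runs through z a', z a, z b, z b'. The two 2 * h in the [cell_dist] terms
    pay for its end pieces, h each, and for the 2 * h removed in [cell_gap]. *)
Lemma eucl_dist_le_cells a b a' b' x y : Q a' x -> Q b' y ->
  eucl_dist x y <= cell_dist a a' + cell_gap a b + cell_dist b b'.
Proof.
move=> Qx Qy; rewrite /cell_dist [eucl_dist (z a) _]eucl_distC.
have gap : eucl_dist (z a) (z b) - 2 * h <= cell_gap a b.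
  by rewrite /cell_gap le_max lexx orbT.
have := Qz Qx; have := Qz Qy; rewrite [eucl_dist y _]eucl_distC.
have := eucl_dist_triangle x (z a') y; have := eucl_dist_triangle (z a') (z a) y.
have := eucl_dist_triangle (z a) (z b) y; have := eucl_dist_triangle (z b) (z b') y.
lra.
Qed.

Section plan_transfer.
Variables (mu nu mu' nu' : probability (Rd R d) R) (alpha s A B : R).
Variable gamma : {measure set (Rd R d * Rd R d)%type -> \bar R}.
Hypothesis A0 : 0 < A.
Hypothesis B0 : 0 < B.
Hypothesis plan : partial_plan mu nu alpha gamma.
Hypothesis mu1 : \sum_a cell_mass mu a = 1.
Hypothesis nu1 : \sum_a cell_mass nu a = 1.
Hypothesis cost : (\int[gamma]_x ((eucl_dist x.1 x.2) `^ p)%:E <= (A `^ p)%:E)%E.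

(** A quadruple t = ((a, a'), (b, b')) means that mass of the plan in block (a, b) is redirected to
    block (a', b'). There it is spread in proportion to the product of mu' and nu', which keeps the
    marginals under mu' and nu' on every measurable set and not just on cells. *)
Lemma partial_plan_transfer :
  cell_coupling mu mu' s B -> cell_coupling nu nu' s B ->
  exists (gamma' : {measure set (Rd R d * Rd R d)%type -> \bar R}) (m : R),
    [/\ partial_plan mu' nu' m gamma', alpha - 2 * s <= m &
       (\int[gamma']_x ((eucl_dist x.1 x.2) `^ p)%:E <= ((B + A + B) `^ p)%:E)%E].
Proof.
move=> [M [M0 Mu Mu' Ms MB]] [L [L0 Lv Lv' Ls LB]].
pose G := discrete_plan gamma.
have G0 : forall a b, 0 <= G a b by exact: discrete_plan_ge0.
have Gu : forall a, \sum_b G a b <= cell_mass mu a by move=> a; exact: (discrete_plan_row plan).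
have Gv : forall b, \sum_a G a b <= cell_mass nu b by move=> b; exact: (discrete_plan_col plan).
pose w := glue G M L (cell_mass mu) (cell_mass nu).
have w0 t : 0 <= w t by exact: (glue_ge0 G0 M0 L0 Gu Gv).
pose u' := cell_mass mu'; pose v' := cell_mass nu'.
have u'0 a : 0 <= u' a by exact: cell_mass_ge0.
have v'0 a : 0 <= v' a by exact: cell_mass_ge0.
pose W (t : (I * I) * (I * I)) := w t / (u' t.1.2 * v' t.2.2).
have W0 t : 0 <= W t by rewrite divr_ge0// mulr_ge0.
have Mle a b : M a b <= u' b.
  by apply: le_trans (Mu' b); rewrite (bigD1 a)//= lerDl sumr_ge0.
have Lle a b : L a b <= v' b.
  by apply: le_trans (Lv' b); rewrite (bigD1 a)//= lerDl sumr_ge0.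
(* Division by a zero block mass loses nothing: [M] and [L] are dominated by [u'] and [v'], so the
   glued weight vanishes there too. *)
have Wu t : W t * (u' t.1.2 * v' t.2.2) = w t.
  rewrite /W; have [uv|uv] := eqVneq (u' t.1.2 * v' t.2.2) 0; last by rewrite divfK.
  rewrite uv mulr0; apply/esym/eqP; rewrite /w /glue.
  move/eqP: uv; rewrite mulf_eq0 => /orP[/eqP u0|/eqP v0].
    have -> : M t.1.1 t.1.2 = 0 by apply/eqP; rewrite eq_le M0 andbT -u0.
    by rewrite mul0r mulr0 mul0r.
  have -> : L t.2.1 t.2.2 = 0 by apply/eqP; rewrite eq_le L0 andbT -v0.
  by rewrite mul0r mulr0.
pose pm := product_measure1 mu' nu'.
have pmE X Y : measurable X -> measurable Y ->
    pm (X `*` Y) = (fine (mu' X) * fine (nu' Y))%:E.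
  move=> mX mY; rewrite [LHS]product_measure1E// EFinM.
  by congr (_ * _)%E; rewrite fineK// fin_num_measure.
pose m (t : (I * I) * (I * I)) : {measure set (Rd R d * Rd R d)%type -> \bar R} :=
  mrestr pm (mQQ t.1.2 t.2.2).
have m_val t X : m t X = pm (X `&` (Q t.1.2 `*` Q t.2.2)) by [].
have [gamma' [gE gint]] := weighted_measure_sum m W0.
exists gamma', (\sum_t w t); split.
- split.
    rewrite gE -sumEFin; apply: eq_bigr => t _.
    rewrite m_val setTI pmE// -EFinM.
    by rewrite Wu.
  move=> E mE.
  have fE (m0 : probability (Rd R d) R) a : m0 (E `&` Q a) = (fine (m0 (E `&` Q a)))%:E.
    by rewrite fineK// fin_num_measure//; exact: measurableI.
  have dE (m0 : probability (Rd R d) R) : (\sum_a m0 (E `&` Q a) <= m0 E)%E.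
    apply: sum_measure_disjoint_le => //; first by move=> a; exact: measurableI.
    by apply: trivIset_setIl.
  split; rewrite gE.
    (* The share of the cell a' that lies in E. Testing the glued weights against it gives a bound
       for the first marginal of E, and summing [M a a'] over a then cancels the denominator. *)
    pose f (a a' : I) := fine (mu' (E `&` Q a')) / u' a'.
    have f0 a a' : 0 <= f a a' by rewrite divr_ge0// fine_ge0.
    apply: (@le_trans _ _ (\sum_t w t * f t.1.1 t.1.2)%:E).
      rewrite -sumEFin; apply: lee_sum => t _.
      rewrite m_val.
      rewrite (_ : _ `&` _ = (E `&` Q t.1.2) `*` Q t.2.2); last first.
        by rewrite -setXI setTI.
      rewrite pmE//; last exact: measurableI.
      rewrite -EFinM lee_fin /f /W -/(cell_mass nu' _) -/(v' _).
      have [v0|v0] := eqVneq (v' t.2.2) 0.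
        by rewrite v0 !mulr0 mulr_ge0//; exact: (f0 t.1.1).
      rewrite invfM le_eqVlt; apply/orP; left; apply/eqP.
      set iu := _^-1; set x := fine _; set y := w t.
      have -> : y * (iu * (v' t.2.2)^-1) * (x * v' t.2.2) =
                y * (x * iu) * ((v' t.2.2)^-1 * v' t.2.2) by ring.
      by rewrite mulVf// mulr1.
    apply: (@le_trans _ _ (\sum_a \sum_a' M a a' * f a a')%:E).
      by rewrite lee_fin; exact: (glue_fst_le G0 M0 L0 Gu Gv Lv f0).
    apply: le_trans (dE mu'); rewrite exchange_big -sumEFin; apply: lee_sum => a' _.
    rewrite fE lee_fin /f -mulr_suml.
    apply: (@le_trans _ _ (u' a' * (fine (mu' (E `&` Q a')) / u' a'))).
      by rewrite ler_wpM2r//; exact: (f0 a').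
    have [u0|u0] := eqVneq (u' a') 0; first by rewrite u0 mul0r fine_ge0.
    by rewrite mulrC divfK.
  pose f (a a' : I) := fine (nu' (E `&` Q a')) / v' a'.
  have f0 a a' : 0 <= f a a' by rewrite divr_ge0// fine_ge0.
  apply: (@le_trans _ _ (\sum_t w t * f t.2.1 t.2.2)%:E).
    rewrite -sumEFin; apply: lee_sum => t _.
    rewrite m_val.
    rewrite (_ : _ `&` _ = Q t.1.2 `*` (E `&` Q t.2.2)); last first.
      by rewrite -setXI setTI.
    rewrite pmE//; last exact: measurableI.
    rewrite -EFinM lee_fin /f /W -/(cell_mass mu' _) -/(u' _).
    have [v0|v0] := eqVneq (u' t.1.2) 0.
      by rewrite v0 !(mul0r, mulr0) mulr_ge0//; exact: (f0 t.2.1).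
    rewrite invfM le_eqVlt; apply/orP; left; apply/eqP.
    set iu := (v' _)^-1; set x := fine _; set y := w t.
    have -> : y * ((u' t.1.2)^-1 * iu) * (u' t.1.2 * x) =
              y * (x * iu) * ((u' t.1.2)^-1 * u' t.1.2) by ring.
    by rewrite mulVf// mulr1.
  apply: (@le_trans _ _ (\sum_a \sum_a' L a a' * f a a')%:E).
    by rewrite lee_fin; exact: (glue_snd_le G0 M0 L0 Gu Gv Mu f0).
  apply: le_trans (dE nu'); rewrite exchange_big -sumEFin; apply: lee_sum => a' _.
  rewrite fE lee_fin /f -mulr_suml.
  apply: (@le_trans _ _ (v' a' * (fine (nu' (E `&` Q a')) / v' a'))).
    by rewrite ler_wpM2r//; exact: (f0 a').
  have [u0|u0] := eqVneq (v' a') 0; first by rewrite u0 mul0r fine_ge0.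
  by rewrite mulrC divfK.
- have := glue_mass_ge G0 M0 L0 Gu Gv Mu Lv.
  rewrite mu1 nu1; apply: le_trans.
  by have := discrete_plan_mass plan mu1 nu1; lra.
- rewrite gint; [|by move=> x; rewrite lee_fin powR_ge0|exact: measurable_eucl_dist].
  pose f1 (t : (I * I) * (I * I)) := cell_dist t.1.1 t.1.2.
  pose f2 (t : (I * I) * (I * I)) := cell_gap t.1.1 t.2.1.
  pose f3 (t : (I * I) * (I * I)) := cell_dist t.2.1 t.2.2.
  have cd0 a b : 0 <= cell_dist a b by rewrite addr_ge0 ?mulr_ge0// eucl_dist_ge0.
  have cg0 a b : 0 <= cell_gap a b by rewrite /cell_gap le_max lexx.
  apply: (@le_trans _ _ (\sum_t w t * (f1 t + f2 t + f3 t) `^ p)%:E).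
    rewrite -sumEFin; apply: lee_sum => t _.
    rewrite -[in leRHS](Wu t) -[in leRHS]mulrA [leRHS]EFinM.
    have Wt : (0 <= (W t)%:E)%E by rewrite lee_fin.
    apply: (lee_wpmul2l Wt).
    apply: le_trans (integral_mrestr_le _ _ (powR_ge0 (f1 t + f2 t + f3 t) p) _ _ _) _.
    + by move=> x; rewrite lee_fin powR_ge0.
    + exact: measurable_eucl_dist.
    + move=> [x y] /= [Qx Qy]; rewrite lee_fin ge0_ler_powR// ?nnegrE ?eucl_dist_ge0//.
        exact: addr_ge0 (addr_ge0 (cd0 _ _) (cg0 _ _)) (cd0 _ _).
      exact: eucl_dist_le_cells.
    + by rewrite (_ : _ (_ `*` _) = pm (Q t.1.2 `*` Q t.2.2))// pmE// -EFinM mulrC.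
  (* Minkowski twice: B for the coupling on the first marginal, A for the discretised plan, B for
     the coupling on the second marginal. *)
  rewrite lee_fin; apply: sum_powR_minkowski => //.
  + by rewrite addr_gt0.
  + by move=> t; exact: addr_ge0 (cd0 _ _) (cg0 _ _).
  + by move=> t; exact: cd0.
  + apply: sum_powR_minkowski => //.
    * by move=> t; exact: cd0.
    * by move=> t; exact: cg0.
    * apply: le_trans (glue_fst_le G0 M0 L0 Gu Gv Lv _) MB => a b.
      exact: powR_ge0.
    apply: le_trans (glue_mid_le G0 M0 L0 Gu Gv Mu Lv (f := fun a b => cell_gap a b `^ p) _) _.
      by move=> a b; exact: powR_ge0.
    by rewrite -lee_fin; apply: le_trans cost; exact: (discrete_plan_cost plan).
  + apply: le_trans (glue_snd_le G0 M0 L0 Gu Gv Mu _) LB => a b.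
    exact: powR_ge0.
Qed.

End plan_transfer.
End transfer.

(** * Stability of the robust partial Wasserstein distance *)

Section rpw.
Variables (R : realType) (d : nat) (p k : R).
Hypothesis p1 : 1 <= p.
Hypothesis k0 : 0 < k.
Implicit Types mu nu : probability (Rd R d) R.
Implicit Types gamma : {measure set (Rd R d * Rd R d)%type -> \bar R}.

Let p0 : 0 < p. Proof. exact: lt_le_trans p1. Qed.

Let integral_dist_ge0 gamma :
  (0 <= \int[gamma]_x ((eucl_dist x.1 x.2) `^ p)%:E)%E.
Proof. by apply: integral_ge0 => x _; rewrite lee_fin powR_ge0. Qed.

Lemma wcost_le gamma (t : R) : 0 <= t ->
  (wcost p gamma <= t%:E)%E <->
  (\int[gamma]_x ((eucl_dist x.1 x.2) `^ p)%:E <= (t `^ p)%:E)%E.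
Proof.
move=> t0; rewrite /wcost; set J := integral _ _ _.
have J0 : (0 <= J)%E by exact: integral_dist_ge0.
split=> [|] h.
  have -> : J = ((J `^ p^-1) `^ p)%E by rewrite -poweRrM mulVf ?gt_eqF// poweRe1.
  rewrite -poweR_EFin; apply: (gt0_ler_poweR (ltW p0)) => //.
    by rewrite in_itv/= leey andbT poweR_ge0.
  by rewrite in_itv/= leey andbT lee_fin.
have -> : t%:E = ((t%:E `^ p) `^ p^-1)%E.
  by rewrite -poweRrM mulfV ?gt_eqF// poweRe1.
have Vp0 : 0 <= p^-1 by rewrite invr_ge0 ltW.
apply: (gt0_ler_poweR Vp0); [| |exact: h].
- by rewrite in_itv/= leey andbT.
- by rewrite in_itv/= leey andbT lee_fin powR_ge0.
Qed.

Lemma RPW_ge0 (mu nu : set (Rd R d) -> \bar R) : (0 <= RPW p k mu nu)%E.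
Proof.
by apply: le_ereal_inf_tmp => _ [e [/andP[e0 _] _] <-]; rewrite lee_fin.
Qed.

Lemma RPW_le1 mu nu : (RPW p k mu nu <= 1)%E.
Proof.
apply: ereal_inf_lbound; exists 1 => //=; split; first by rewrite ler01 lexx.
rewrite subrr mulr1; apply: (@le_trans _ _ 0%E); last by rewrite lee_fin ltW.
apply: (@le_trans _ _ (wcost p (@mzero _ (Rd R d * Rd R d)%type R))).
  apply: ereal_inf_lbound; exists mzero => //; split=> // A mA.
  by split; exact: measure_ge0.
by rewrite wcost_le// powR0 ?gt_eqF// integral_measure_zero.
Qed.

(** [Wpa] asks for mass exactly alpha, whereas a transferred plan may be heavier: scaling it by
    alpha / m decreases its marginals and its cost. If m = 0 then alpha = 0 as well. *)
Lemma Wpa_le_of_plan mu nu gamma (m alpha t : R) : 0 <= alpha <= m -> 0 <= t ->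
  partial_plan mu nu m gamma ->
  (\int[gamma]_x ((eucl_dist x.1 x.2) `^ p)%:E <= (t `^ p)%:E)%E ->
  (Wpa p alpha mu nu <= t%:E)%E.
Proof.
move=> /andP[a0 am] t0 [gm gle] cost.
have r0 : 0 <= alpha / m by rewrite divr_ge0// (le_trans a0).
have r1 : alpha / m <= 1.
  have [->|m0] := eqVneq m 0; first by rewrite invr0 mulr0.
  by rewrite ler_pdivrMr ?mul1r// lt0r m0 (le_trans a0).
have shrink (x : \bar R) : (0 <= x)%E -> ((alpha / m)%:E * x <= x)%E.
  by move=> x0; rewrite -[leRHS]mul1e lee_wpmul2r// lee_fin.
apply: (@le_trans _ _ (wcost p (mscale (NngNum r0) gamma))).
  apply: ereal_inf_lbound; exists (mscale (NngNum r0) gamma) => //; split.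
    rewrite /= /mscale/= gm -EFinM; have [m0|m0] := eqVneq m 0; last by rewrite divfK.
    have a00 : alpha = 0 by apply/eqP; rewrite eq_le a0 andbT -m0.
    by rewrite m0 mulr0 a00.
  by move=> A mA; have [h1 h2] := gle A mA; split;
    rewrite /= /mscale/=; (apply: le_trans (shrink _ _) _; first exact: measure_ge0).
rewrite wcost_le// ge0_integral_mscale//=; last 2 first.
- exact: measurable_eucl_dist.
- by move=> x _; rewrite lee_fin powR_ge0.
exact: le_trans (shrink _ (integral_dist_ge0 _)) cost.
Qed.

Variables (I : finType) (Q : I -> set (Rd R d)) (z : I -> 'rV[R]_d) (h : R).
Hypothesis mQ : forall a, measurable (Q a).
Hypothesis tQ : trivIset setT Q.
Hypothesis Qz : forall a x, Q a x -> eucl_dist x (z a) <= h.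
Hypothesis h0 : 0 <= h.

(** The two couplings drop mass 2 * s and add 2 * B to the cost; a value e feasible for (mu, nu)
    thus makes e + delta feasible for (mu', nu'), unless it reaches 1, where [RPW_le1] applies. *)
Lemma RPW_transfer mu nu mu' nu' (s B delta : R) :
  \sum_a cell_mass Q mu a = 1 -> \sum_a cell_mass Q nu a = 1 ->
  cell_coupling Q z h p mu mu' s B -> cell_coupling Q z h p nu nu' s B ->
  0 < B -> 2 * s <= delta -> 3 * B <= k * delta ->
  (RPW p k mu' nu' <= RPW p k mu nu + delta%:E)%E.
Proof.
move=> mu1 nu1 cmu cnu B0 sd Bd.
have d0 : 0 < delta by rewrite -(pmulr_rgt0 _ k0); apply: lt_le_trans Bd; lra.
rewrite -leeBlDr//; apply: le_ereal_inf_tmp => _ [e [/andP[e0 e1] We] <-].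
rewrite leeBlDr// -EFinD; have [ed1|ed1] := leP 1 (e + delta).
  by apply: (le_trans (RPW_le1 _ _)); rewrite lee_fin.
apply: ereal_inf_lbound; exists (e + delta) => //=; split.
  by apply/andP; split; lra.
have ke0 : 0 <= k * e by exact: mulr_ge0 (ltW k0) e0.
have kd0 : 0 <= k * (e + delta) by exact: mulr_ge0 (ltW k0) (addr_ge0 e0 (ltW d0)).
(* The third [B] of the hypothesis is spent here: the infimum need not be attained, and the cost
   bound must be positive even if e = 0. *)
have : (Wpa p (1 - e) mu nu < (k * e + B)%:E)%E.
  by apply: (le_lt_trans We); rewrite lte_fin ltrDl.
move=> /ereal_inf_lt[_ [gamma plan <-]] /ltW.
have A0 : 0 < k * e + B by lra.
move=> /(wcost_le _ (ltW A0)) cost.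
have [gamma' [m [plan' m_ge cost']]] :=
  partial_plan_transfer mQ tQ Qz h0 p1 A0 B0 plan mu1 nu1 cost cmu cnu.
apply: (Wpa_le_of_plan _ _ plan').
- by apply/andP; split; lra.
- by [].
- apply: (le_trans cost'); rewrite lee_fin ge0_ler_powR ?nnegrE ?(ltW p0)//; first by lra.
  by rewrite mulrDr; lra.
Qed.

End rpw.

(** * Deviations of the empirical measure *)

Section empirical_measure.
Variables (R : realType) (d : nat).

Lemma empiricalE n (x : 'I_n -> Rd R d) (A : set (Rd R d)) :
  empirical x A = ((\sum_i (x i \in A)%:R) / n%:R)%:E.
Proof.
rewrite /empirical -natr_sum; congr ((_%:R / _)%:E).
rewrite -sum1_card big_mkcond/=; apply: eq_bigr => i _.
by rewrite unfold_in /in_set asboolb; case: (_ \in _).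
Qed.

Lemma empirical_probability n (x : 'I_n -> Rd R d) (P0 : probability (Rd R d) R) :
  (0 < n)%N ->
  exists P : probability (Rd R d) R, (P : set (Rd R d) -> \bar R) = empirical x.
Proof.
move=> n0; have Vn0 : forall i : 'I_n, 0 <= (n%:R : R)^-1 by move=> _; rewrite invr_ge0.
have [M [ME _]] := weighted_measure_sum (fun i => \d_(x i)) Vn0.
have {}ME : (M : set (Rd R d) -> \bar R) = empirical x.
  apply/funext => A; rewrite ME empiricalE mulr_suml -sumEFin; apply: eq_bigr => i _.
  by rewrite /= diracE -EFinM mulrC.
rewrite -ME; apply: unit_mass_probability => //.
rewrite ME empiricalE; congr _%:E.
rewrite (eq_bigr (fun=> 1)); last by move=> i _; rewrite in_setT.
by rewrite sumr_const card_ord divff// pnatr_eq0 -lt0n.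
Qed.

Section sampling.
Variables (dO : measure_display) (O : measurableType dO) (P : probability O R).
Variables (n : nat) (X : 'I_n -> O -> Rd R d) (mu : probability (Rd R d) R).
Hypothesis n0 : (0 < n)%N.
Hypothesis Xlaw : forall i, has_law P (X i) mu.
Hypothesis Xindep : forall A : 'I_n -> set (Rd R d), (forall i, measurable (A i)) ->
  fine (P (\bigcap_i (X i @^-1` A i))) = \prod_i fine (P (X i @^-1` A i)).

(** One tail is enough, because the excess only adds up positive parts of mu minus the empirical
    measure. *)
Lemma empirical_lower_tail (A : set (Rd R d)) (s : R) : measurable A -> 0 <= s ->
  exists B : set O,
    [/\ measurable B, (P B <= (expR (- (n%:R * s ^+ 2 / 4)))%:E)%E &
      forall w, ~ B w ->
        fine (mu A) - fine (empirical (fun i => X i w) A) <= s].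
Proof.
move=> mA s0; pose q := fine (mu A).
have mX i B : measurable B -> measurable (X i @^-1` B).
  by move=> mB; rewrite -[_ @^-1` _]setTI; exact: (Xlaw i).1.
have q01 : 0 <= q <= 1.
  rewrite fine_ge0//= -lee_fin fineK ?fin_num_measure//.
  exact: probability_le1.
have pat (f : {ffun 'I_n -> bool}) :
    fine (P (\bigcap_i (if f i then X i @^-1` A else ~` (X i @^-1` A)))) =
    \prod_i (if f i then q else 1 - q).
  transitivity (fine (P (\bigcap_i (X i @^-1` (if f i then A else ~` A))))).
    by congr (fine (P _)); apply: eq_bigcapr => i _; case: (f i).
  rewrite Xindep; last by move=> i; case: (f i) => //; exact: measurableC.
  apply: eq_bigr => i _; case: (f i); first by rewrite (Xlaw i).2.
  rewrite (Xlaw i).2; last exact: measurableC.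
  by rewrite probability_setC// fineB// fin_num_measure.
have [mB PB] := bernoulli_lower_tail (fun i => mX i A mA) q01 s0 pat.
eexists; split; [exact: mB|exact: PB|].
move=> w /negP; rewrite -ltNge empiricalE /= => h.
by rewrite lerBlDr -lerBlDl ler_pdivlMr ?ltr0n// mulrC ltW// (lt_le_trans h).
Qed.

Variables (I T : finType) (q : I -> T) (Q : I -> set (Rd R d)).
Hypothesis mQ : forall a, measurable (Q a).
Hypothesis tQ : trivIset setT Q.

(* The excess over a partition is attained on the union of the cells where mu
   dominates, so controlling the deviation on all unions of cells suffices. *)
Lemma empirical_excess (s : R) : 0 <= s ->
  exists B : set O,
    [/\ measurable B,
      (P B <= (2 ^+ #|T| * expR (- (n%:R * s ^+ 2 / 4)))%:E)%E &
      forall w, ~ B w ->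
        \sum_t Num.max 0 (fiber_mass q (cell_mass Q mu) t -
          fiber_mass q (cell_mass Q (empirical (fun i => X i w))) t) <= s].
Proof.
move=> s0.
pose F (S : {set T}) a := if q a \in S then Q a else set0.
have mF S a : measurable (F S a) by rewrite /F; case: ifP.
have tF S : trivIset setT (F S).
  apply/trivIsetP => a b _ _ ab; rewrite /F; move/trivIsetP: tQ => disj.
  by case: ifP => _; case: ifP => _; rewrite ?setI0 ?set0I//; exact: disj.
pose A S := \bigcup_a F S a.
have mA S : measurable (A S) by apply: (fin_bigcup_measurable finite_finset).
have massE (m : probability (Rd R d) R) S :
    fine (m (A S)) = \sum_(t in S) fiber_mass q (cell_mass Q m) t.
  have -> : m (A S) = (\sum_(a | q a \in S) cell_mass Q m a)%:E.
    rewrite /A measure_disjoint_bigcup// -sumEFin [RHS]big_mkcond/=.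
    apply: eq_bigr => a _; rewrite /F; case: ifP => _; last exact: measure0.
    by rewrite fineK// fin_num_measure.
  rewrite /= (partition_big q (mem S))//=; apply: eq_bigr => t tS.
  by apply: eq_bigl => a; case: eqP => [->|]; rewrite ?andbF// tS.
have H S := empirical_lower_tail (mA S) s0.
pose B S := projT1 (cid (H S)).
have BP S : [/\ measurable (B S), (P (B S) <= (expR (- (n%:R * s ^+ 2 / 4)))%:E)%E &
      forall w, ~ B S w ->
        fine (mu (A S)) - fine (empirical (fun i => X i w) (A S)) <= s].
  exact: projT2 (cid (H S)).
exists (\bigcup_(S in [set S : {set T} | true]) B S); split.
- by apply: (fin_bigcup_measurable finite_finset) => S _; case: (BP S).
- apply: le_trans (measure_fin_bigcup_le _ _ _) _; first by move=> S; case: (BP S).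
  apply: (@le_trans _ _ (\sum_(S : {set T}) (expR (- (n%:R * s ^+ 2 / 4)))%:E)%E).
    by apply: lee_sum => S _; case: (BP S).
  have c2 : #|{: {set T}}| = (2 ^ #|T|)%N.
    by rewrite -[LHS]cardsT -powersetT card_powerset cardsT.
  by rewrite sumEFin sumr_const -[_ *+ _]mulr_natl c2 natrX.
- move=> w nB; have [m mE] := empirical_probability (fun i => X i w) mu n0.
  rewrite -mE; set u := fiber_mass q _; set v := fiber_mass q _.
  pose S := [set t | v t < u t]%SET.
  have := (BP S).
  case=> _ _ /(_ w); rewrite -mE !massE -sumrB => h.
  apply: le_trans (h _); last by move=> BS; apply: nB; exists S.
  rewrite [leRHS]big_mkcond/=; apply: ler_sum => t _; rewrite inE -/u -/v.
  case: ltP => uv; first by rewrite max_r// subr_ge0 ltW.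
  by rewrite max_l// subr_le0.
Qed.

End sampling.
End empirical_measure.

(** * Dyadic cells of the compact support *)

Section dyadic_cubes.
Variables (R : realType) (d J : nat).

Definition dyadic (j : nat) : finType := {ffun 'I_d -> 'I_(2 ^ j)}.

Lemma card_dyadic j : #|dyadic j| = (2 ^ (d * j))%N.
Proof. by rewrite card_ffun !card_ord -expnM mulnC. Qed.

Lemma ancestor_subproof j (m : 'I_(2 ^ J)) : (m %/ 2 ^ (J - j) < 2 ^ j)%N.
Proof.
rewrite ltn_divLR ?expn_gt0// -expnD; apply: leq_trans (ltn_ord m) _.
by rewrite leq_exp2l// -leq_subLR.
Qed.

(** For j >= J the truncated J - j is 0 and indices keep their values, so the partitions are
    stationary from level J on. This gives a nested family over all j, and explains the [minn j J]
    in the distance bounds. *)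
Definition ancestor j (a : dyadic J) : dyadic j :=
  [ffun i => Ordinal (ancestor_subproof j (a i))].

Lemma ancestor_eq j (a b : dyadic J) : ancestor j a = ancestor j b ->
  forall i, (a i %/ 2 ^ (J - j) = b i %/ 2 ^ (J - j))%N.
Proof. by move=> /ffunP ab i; have := ab i; rewrite !ffunE => -[]. Qed.

Lemma ancestor_nested j (a b : dyadic J) :
  ancestor j.+1 a = ancestor j.+1 b -> ancestor j a = ancestor j b.
Proof.
move=> /ancestor_eq ab; apply/ffunP => i; rewrite !ffunE; apply/val_inj => /=.
have [jJ|Jj] := ltnP j J; last first.
  have := ab i; have /eqP -> : (J - j == 0)%N by rewrite subn_eq0.
  have /eqP -> : (J - j.+1 == 0)%N by rewrite subn_eq0 ltnW.
  by [].
have -> : (J - j = (J - j.+1).+1)%N by rewrite subnSK.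
by rewrite expnSr !divnMA ab.
Qed.

Variables (K : set 'rV[R]_d) (x0 : 'rV[R]_d).
Hypothesis cK : compact K.
Hypothesis diamK : forall x y, K x -> K y -> eucl_dist x y <= 1.
Hypothesis Kx0 : K x0.

Let N : R := 2 ^+ J.
Let N0 : 0 < N. Proof. exact: exprn_gt0. Qed.
Let NV0 : 0 <= N^-1. Proof. by rewrite invr_ge0 ltW. Qed.

(* K lies in the cube of side 4 with corner x0 - 1, cut into 2 ^ J slices in
   each direction; [slice x i] is the real-valued slice number. *)
Definition slice (x : 'rV[R]_d) i : R := N * ((x ord0 i - x0 ord0 i + 1) / 4).

Definition dyadic_cell (a : dyadic J) : set (Rd R d) :=
  K `&` \bigcap_i [set x | (a i)%:R <= slice x i < (a i)%:R + 1].

Definition dyadic_corner (a : dyadic J) : 'rV[R]_d :=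
  \row_i (x0 ord0 i - 1 + 4 * ((a i)%:R / N)).

Lemma measurable_dyadic_cell a : measurable (dyadic_cell a).
Proof.
apply: measurableI; first exact: compact_measurable_Rd.
apply: (fin_bigcap_measurable finite_finset) => i _.
have mf : measurable_fun setT (fun x : Rd R d => slice x i).
  apply: measurable_funM => //; apply: measurable_funM => //.
  apply: measurable_funD => //; apply: measurable_funB => //.
  exact: measurable_coord.
rewrite (_ : [set x | _] = [set: Rd R d] `&`
    (fun x : Rd R d => slice x i) @^-1` `[(a i)%:R, (a i)%:R + 1[%classic); last first.
  by rewrite setTI; apply/seteqP; split=> x /=; rewrite in_itv.
by apply: mf => //; exact: measurable_itv.
Qed.

Lemma trivIset_dyadic_cell : trivIset setT dyadic_cell.
Proof.
apply/trivIsetP => a b _ _ ab; apply/seteqP; split=> // x [[_ xa] [_ xb]] /=.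
move/eqP: ab; apply; apply/ffunP => i; apply/val_inj/eqP; rewrite eqn_leq /=.
have /andP[a1 a2] := xa i Logic.I; have /andP[b1 b2] := xb i Logic.I.
apply/andP; split; rewrite -ltnS -(ltr_nat R) -natr1.
  exact: le_lt_trans b2.
exact: le_lt_trans a2.
Qed.

Lemma dyadic_cell_cover x : K x -> exists a, dyadic_cell a x.
Proof.
move=> Kx.
(* Coordinates of x are within 1 of those of x0, so the quotient by 4 lies in [0, 1 / 2] and the
   half-open slices contain x with room to spare. *)
have sl i : 0 <= slice x i < N.
  have := le_trans (coord_le_eucl_dist x x0 i) (diamK Kx Kx0).
  rewrite ler_norml => /andP[l1 l2]; rewrite /slice; apply/andP; split.
    by apply: mulr_ge0; [exact: ltW|lra].
  by rewrite -[ltRHS]mulr1 ltr_pM2l//; lra.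
have tr i : (Num.truncn (slice x i) < 2 ^ J)%N.
  have /andP[s0 s1] := sl i; have /andP[t1 _] := truncn_itv s0.
  by rewrite -(ltr_nat R) natrX; exact: le_lt_trans s1.
exists [ffun i => Ordinal (tr i)]; split=> // i _ /=; rewrite ffunE/=.
have /andP[s0 s1] := sl i; have /andP[t1 t2] := truncn_itv s0.
by rewrite t1 /= natr1.
Qed.

Lemma dyadic_cell_mass (m : probability (Rd R d) R) :
  m K = 1%E -> \sum_a cell_mass dyadic_cell m a = 1.
Proof.
move=> mK; apply: EFin_inj; rewrite -sumEFin -[RHS]mK.
have -> : (K : set (Rd R d)) = \bigcup_a dyadic_cell a.
  apply/seteqP; split=> x; last by move=> [a _ []].
  by move=> /dyadic_cell_cover[a]; exists a.
rewrite measure_disjoint_bigcup.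
- by apply: eq_bigr => a _; rewrite fineK// fin_num_measure//; exact: measurable_dyadic_cell.
- exact: measurable_dyadic_cell.
- exact: trivIset_dyadic_cell.
Qed.

Lemma dyadic_cell_corner a x :
  dyadic_cell a x -> eucl_dist x (dyadic_corner a) <= d%:R * (4 / N).
Proof.
move=> [_ xa]; apply: eucl_dist_le_coord; first by rewrite divr_ge0// ltW.
move=> i; rewrite mxE; have /andP[] := xa i Logic.I; rewrite /slice => a1 a2.
set t := (x ord0 i - x0 ord0 i + 1) / 4 in a1 a2.
have -> : x ord0 i - (x0 ord0 i - 1 + 4 * ((a i)%:R / N)) = 4 * (t - (a i)%:R / N).
  by rewrite /t; field; rewrite gt_eqF.
rewrite normrM ger0_norm// ler_pM2l//.
have -> : t - (a i)%:R / N = (N * t - (a i)%:R) / N by field; rewrite gt_eqF.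
rewrite normrM [X in _ * X]ger0_norm// -[leRHS]mul1r ler_pM2r ?invr_gt0//.
by rewrite ler_norml; lra.
Qed.

(** 12 = 4 + 2 * 4: the corners of two cells with a common ancestor are within 4 * d / 2 ^ (minn j
    J), and twice the cell radius adds at most double that. Indices with equal quotients by 2 ^ (J -
    j) differ only in their remainders. *)
Lemma dyadic_corner_dist j a b : ancestor j a = ancestor j b ->
  cell_dist dyadic_corner (d%:R * (4 / N)) a b <= 12 * d%:R / 2 ^+ (minn j J).
Proof.
move=> /ancestor_eq ab; set M : R := 2 ^+ minn j J.
have M0 : 0 < M by exact: exprn_gt0.
have MN : N^-1 <= M^-1.
  by rewrite lef_pV2 ?posrE// /M /N ler_weXn2l ?ler1n// geq_minr.
have dd : eucl_dist (dyadic_corner a) (dyadic_corner b) <= d%:R * (4 / M).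
  apply: eucl_dist_le_coord; first by rewrite divr_ge0// ltW.
  move=> i; rewrite !mxE.
  have -> : x0 ord0 i - 1 + 4 * ((a i)%:R / N) - (x0 ord0 i - 1 + 4 * ((b i)%:R / N)) =
    4 * (((a i)%:R - (b i)%:R) / N) by field; rewrite gt_eqF.
  rewrite normrM ger0_norm// ler_pM2l// normrM [X in _ * X]ger0_norm//.
  rewrite ler_pdivrMr//.
  have -> : M^-1 * N = 2 ^+ (J - j).
    have -> : N = M * 2 ^+ (J - j).
      by rewrite /N /M -exprD minnC minnE subnK// leq_subr.
    by rewrite mulKf// gt_eqF.
  have m0 : (0 < 2 ^ (J - j))%N by rewrite expn_gt0.
  have ea := divn_eq (a i) (2 ^ (J - j)); have eb := divn_eq (b i) (2 ^ (J - j)).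
  have rl := ltn_pmod (a i) m0; have r'l := ltn_pmod (b i) m0.
  set r := (_ %% _)%N in ea rl; set r' := (_ %% _)%N in eb r'l.
  rewrite [X in X%:R - _]ea [X in _ - X%:R]eb ab.
  rewrite -natrX !natrD ler_norml.
  have : (r%:R : R) <= (2 ^ (J - j))%:R by rewrite ler_nat ltnW.
  have : (r'%:R : R) <= (2 ^ (J - j))%:R by rewrite ler_nat ltnW.
  have : 0 <= (r'%:R : R) by []. have : 0 <= (r%:R : R) by [].
  lra.
rewrite /cell_dist; apply: (@le_trans _ _ (d%:R * (4 / M) + 2 * (d%:R * (4 / M)))).
  by rewrite lerD// ler_pM2l// ler_wpM2l// ler_pM2l.
by rewrite le_eqVlt; apply/orP; left; apply/eqP; field; rewrite gt_eqF.
Qed.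

End dyadic_cubes.

(** * Choice of the scales and the resulting rates *)

Section rates.
Variable R : realType.

(** b and t are the exponents of the finest and coarsest scales, 2 ^ J ~ n ^ b and 2 ^ j0 ~ n ^ t.
    The inequality b + t * (d / 2) <= 1 / 2 bounds the dropped mass by the rate; the disjunction
    bounds the cost of the dominating level, the finest or the coarsest. For p > d / 2 both hold
    with equality, and this determines b and t. *)
Lemma rate_parameters (d : nat) (p : R) : (1 <= d)%N -> 1 <= p ->
  exists b t : R,
    [/\ 0 <= t, t <= b, b <= 1, b + t * (d%:R / 2) <= 1 / 2 &
      (forall n, rpw_rate d p n = n%:R `^ (- b)) /\
      ((p <= d%:R / 2 /\ b * (d%:R / 2 - p) - 1 / 2 <= - (b * p)) \/
       (d%:R / 2 < p /\ t * (d%:R / 2 - p) - 1 / 2 <= - (b * p)))].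
Proof.
move=> d1 p1; rewrite /rpw_rate; have d1R : 1 <= d%:R :> R by rewrite ler1n.
have [pd|dp] := leP p (d%:R / 2).
  have d0 : 0 < d%:R :> R by lra.
  exists d%:R^-1, 0; split => //.
  - by rewrite invf_le1.
  - rewrite mul0r addr0 -[d%:R^-1]div1r ler_pdivrMr//; lra.
  - split=> //; left; split=> //.
    by rewrite le_eqVlt; apply/orP; left; apply/eqP; field; rewrite gt_eqF.
set D := p * (d%:R + 2) - d%:R.
have Dge : 2 * p <= D by rewrite /D; nra.
have D0 : 0 < D by lra.
exists (p / D), ((p - 1) / D); split => //.
- by apply: divr_ge0; lra.
- by rewrite ler_pM2r ?invr_gt0//; lra.
- by rewrite ler_pdivrMr//; lra.
- rewrite le_eqVlt; apply/orP; left; apply/eqP; rewrite /D; field.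
  by rewrite -/D gt_eqF.
- split=> //; right; split=> //.
  rewrite le_eqVlt; apply/orP; left; apply/eqP; rewrite /D; field.
  by rewrite -/D gt_eqF.
Qed.

Lemma dyadic_scale (x : R) : 1 <= x -> exists j, 2 ^+ j <= x < 2 ^+ j.+1.
Proof.
move=> x1; have x0 : 0 <= x by exact: le_trans x1.
have /andP[t1 t2] := truncn_itv x0; set m := Num.truncn x in t1 t2.
have m0 : (0 < m)%N by rewrite /m truncn_gt0.
exists (trunc_log 2 m); have /andP[l1 l2] := trunc_log_bounds (isT : (1 < 2)%N) m0.
apply/andP; split; first by apply: le_trans t1; rewrite -natrX ler_nat.
by apply: (lt_le_trans t2); rewrite -natrX ler_nat.
Qed.

(** Obtained by inverting 1 / 2 <= e ^ (- 1 / 2). It yields J <= 2 * ln n from 2 ^ J <= n. *)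
Lemma ln2_ge_half : 1 / 2 <= ln (2 : R).
Proof.
rewrite -ler_expR lnK ?posrE//.
have := @expR_ge1Dx R (- (1 / 2)); rewrite expRN => h.
rewrite -[leLHS]invrK -[leRHS]invrK lef_pV2 ?posrE ?invr_gt0 ?expR_gt0//.
by apply: le_trans h; lra.
Qed.

(* Deviation allowed at level j: it beats the 2 ^ #cells unions of cells of that
   level with a margin n ^ (- 3). *)
Definition level_dev (d n j : nat) : R :=
  4 * Num.sqrt (2 ^+ (d * j) * ln n%:R / n%:R).

Lemma level_dev_ge0 d n j : 0 <= level_dev d n j.
Proof. by rewrite mulr_ge0// sqrtr_ge0. Qed.

Lemma level_devE d n j : (0 < n)%N -> 1 <= ln n%:R :> R ->
  level_dev d n j ^+ 2 * n%:R / 4 = 4 * 2 ^+ (d * j) * ln n%:R.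
Proof.
move=> n0 L1; have n0R : 0 < n%:R :> R by rewrite ltr0n.
rewrite /level_dev exprMn sqr_sqrtr; first by field; rewrite gt_eqF.
by apply: divr_ge0 => //; apply: mulr_ge0; rewrite ?exprn_ge0//; lra.
Qed.

Lemma level_dev_fail d n j : (0 < n)%N -> 1 <= ln n%:R :> R ->
  2 ^+ (2 ^ (d * j)) * expR (- (n%:R * level_dev d n j ^+ 2 / 4)) <= n%:R `^ (- 3).
Proof.
move=> n0 L1; have n0R : 0 < n%:R :> R by rewrite ltr0n.
have -> : n%:R * level_dev d n j ^+ 2 / 4 = 4 * 2 ^+ (d * j) * ln n%:R.
  by rewrite -level_devE// [n%:R * _]mulrC.
set T := (2 ^ (d * j))%N; have T1 : 1 <= T%:R :> R by rewrite ler1n expn_gt0.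
have -> : 2 ^+ (d * j) = T%:R :> R by rewrite natrX.
rewrite /powR gt_eqF//.
(* 2 ^ T <= e ^ T, and 4 * T * ln n - T >= 3 * ln n because T and ln n are at least 1. *)
apply: (@le_trans _ _ (expR T%:R * expR (- (4 * T%:R * ln n%:R)))).
  rewrite ler_wpM2r ?expR_ge0// -[T%:R]mul1r expRM_natr lerXn2r ?nnegrE ?expR_ge0//.
  by have := @expR_ge1Dx R 1; lra.
by rewrite -expRD ler_expR; nra.
Qed.

Lemma level_dev_le d n j : (0 < n)%N -> 1 <= ln n%:R :> R ->
  level_dev d n j <= 4 * ln n%:R * ((2 ^+ j) `^ (d%:R / 2) * n%:R `^ (- (1 / 2))).
Proof.
move=> n0 L1; have n0R : 0 < n%:R :> R by rewrite ltr0n.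
have L0 : 0 <= ln n%:R :> R by lra.
rewrite /level_dev -[leRHS]mulrA ler_pM2l// -[X in Num.sqrt X]mulrA sqrtrM ?exprn_ge0//.
rewrite sqrtrM// mulrCA; apply: ler_pM.
- exact: sqrtr_ge0.
- by apply: mulr_ge0; exact: sqrtr_ge0.
- rewrite -[leRHS](ger0_norm L0) -sqrtr_sqr ler_sqrt ?sqr_ge0//.
  by rewrite expr2 ler_peMl.
rewrite le_eqVlt; apply/orP; left; apply/eqP; congr (_ * _).
  by rewrite powRrM powR_mulrn// -exprM mulnC powR12_sqrt// exprn_ge0.
by rewrite div1r -mulN1r powRrM powR_inv1 ?ltW// powR12_sqrt// invr_ge0 ltW.
Qed.

Lemma rate_bounds (d : nat) (p : R) : (1 <= d)%N -> 1 <= p ->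
  exists2 C : R, 0 < C & forall n : nat, (0 < n)%N -> 1 <= ln n%:R :> R ->
  exists j0 J : nat,
    [/\ (j0 <= J)%N, (J < n)%N,
        level_dev d n j0 <= C * ln n%:R `^ 2 * rpw_rate d p n &
        (12 * d%:R / 2 ^+ J) `^ p +
        \sum_(j0 <= j < J) (12 * d%:R / 2 ^+ j) `^ p * level_dev d n j.+1
        <= (C * ln n%:R `^ 2 * rpw_rate d p n) `^ p].
Proof.
move=> d1 p1; have [b [t [t0 tb b1 bt [rateE cases]]]] := rate_parameters d1 p1.
have p0 : 0 <= p by lra.
(* [A] doubles the constant 12 * d of the cell distances to pay for rounding the scales to powers of
   2. In [E], the 1 is for the finest scale. Each of at most 2 * ln n levels contributes 4 * 2 ^ d *
   ln n, where 2 ^ d covers the step from level j to j + 1 in the deviation; together 8 * 2 ^ d, so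
   16 leaves room. *)
pose A : R := 24 * d%:R; pose E : R := 1 + 16 * 2 ^+ d.
have d1R : 1 <= d%:R :> R by rewrite ler1n.
have A1 : 24 <= A by rewrite /A; lra.
have E1 : 1 <= E by rewrite lerDl mulr_ge0// exprn_ge0.
exists (A * E) => [|n n0 L1]; first by apply: mulr_gt0; lra.
have [L LE] : exists L : R, ln n%:R = L by exists (ln n%:R).
have [m mE] : exists m : R, n%:R = m by exists n%:R.
have devE j := level_dev_le d j n0 L1.
rewrite rateE LE mE; rewrite LE in L1 devE; rewrite mE in devE.
have m1 : 1 <= m by rewrite -mE ler1n.
have m0 : 0 < m by lra.
have L0 : 0 <= L by lra.
have x1 : 1 <= m `^ b by rewrite -(powRr0 m) ler_powR//; lra.
have y1 : 1 <= m `^ t by rewrite -(powRr0 m) ler_powR.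
have [J /andP[J1 J2]] := dyadic_scale x1.
have [j0 /andP[j1 j2]] := dyadic_scale y1.
have j0J : (j0 <= J)%N.
  rewrite -ltnS -(@ltn_exp2l 2)// -(ltr_nat R) !natrX.
  by apply: le_lt_trans J2; apply: (le_trans j1); rewrite ler_powR.
have Jm : 2 ^+ J <= m by apply: (le_trans J1); rewrite -[leRHS]powRr1 ?ler_powR// ltW.
have Jn : (J < n)%N.
  by apply: leq_trans (ltn_expl J (isT : (1 < 2)%N)) _; rewrite -(ler_nat R) natrX mE.
have J2L : J%:R <= 2 * L.
  have : J%:R * ln (2 : R) <= L.
    by rewrite mulr_natl -lnXn// -LE ler_ln ?posrE ?exprn_gt0// mE.
  by have := ln2_ge_half; have : 0 <= J%:R :> R by []; nra.
have LL : L <= L `^ 2 by apply: le1r_powR; lra.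
have L2 : L `^ 2 = L ^+ 2 by rewrite -powR_mulrn.
exists j0, J; split => //.
- apply: (le_trans (devE j0)).
  have h : (2 ^+ j0) `^ (d%:R / 2) * m `^ (- (1 / 2)) <= m `^ (- b).
    apply: (@le_trans _ _ ((m `^ t) `^ (d%:R / 2) * m `^ (- (1 / 2)))).
      rewrite ler_wpM2r ?powR_ge0// ge0_ler_powR ?nnegrE ?powR_ge0 ?exprn_ge0//.
    rewrite -powRrM -powRD; last by rewrite (gt_eqF m0) implybT.
    by rewrite ler_powR//; lra.
  apply: ler_pM => //; first by apply: mulr_ge0; lra.
    by apply: mulr_ge0; exact: powR_ge0.
  by apply: ler_pM => //; nra.
have mb0 : 0 <= m `^ (- b) by exact: powR_ge0.
(* If p <= d / 2 the exponent is nonnegative and 2 ^ j <= n ^ b is used; otherwise it is negative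
   and 2 ^ j >= n ^ t / 2 is used. The factor 2 ^ p absorbs that last half. *)
have key j : (j0 <= j)%N -> (j < J)%N ->
    (2 ^+ j) `^ (d%:R / 2 - p) * m `^ (- (1 / 2)) <= 2 `^ p * m `^ (- (b * p)).
  move=> jj jJ; have pw j' : 0 < 2 ^+ j' :> R by exact: exprn_gt0.
  case: cases => -[pd e].
    apply: (@le_trans _ _ ((m `^ b) `^ (d%:R / 2 - p) * m `^ (- (1 / 2)))).
      rewrite ler_wpM2r ?powR_ge0// ge0_ler_powR ?subr_ge0 ?nnegrE ?powR_ge0 ?exprn_ge0//.
      by apply: le_trans J1; rewrite ler_weXn2l ?ler1n// ltnW.
    rewrite -powRrM -powRD; last by rewrite (gt_eqF m0) implybT.
    apply: (@le_trans _ _ (m `^ (- (b * p)))); first by rewrite ler_powR//; lra.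
    rewrite ler_peMl ?powR_ge0// -[leLHS](powRr0 2).
    by apply: ler_powR; rewrite ?ler1n.
  have y2 : m `^ t / 2 <= 2 ^+ j.
    rewrite ler_pdivrMr// -exprSr; apply: (le_trans (ltW j2)).
    by rewrite ler_weXn2l ?ler1n.
  have y0 : 0 < m `^ t / 2 by rewrite divr_gt0 ?powR_gt0.
  have e' : 0 <= p - d%:R / 2 by lra.
  apply: (@le_trans _ _ ((m `^ t / 2) `^ (d%:R / 2 - p) * m `^ (- (1 / 2)))).
    rewrite ler_wpM2r ?powR_ge0// -opprB !powRN lef_pV2 ?posrE ?powR_gt0//.
    by rewrite ge0_ler_powR ?nnegrE ?(ltW y0) ?exprn_ge0.
  rewrite powRM ?powR_ge0 ?invr_ge0// -powRrM mulrAC -powRD; last by rewrite (gt_eqF m0) implybT.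
  rewrite mulrC; apply: ler_pM; rewrite ?powR_ge0//.
    rewrite -[X in X `^ _ <= _](powR_inv1 (ler0n R 2)) -powRrM ler_powR ?ler1n//.
    rewrite mulN1r opprB gerBl; lra.
  by rewrite ler_powR.
have md : (m `^ (- b)) `^ p = m `^ (- (b * p)) by rewrite -powRrM mulNr.
have cst : 12 * d%:R = A / 2 by rewrite /A; field.
have A0 : 0 <= A by lra.
have leaf : (12 * d%:R / 2 ^+ J) `^ p <= A `^ p * m `^ (- (b * p)).
  rewrite -md -powRM// ge0_ler_powR ?nnegrE ?mulr_ge0 ?invr_ge0 ?exprn_ge0//.
  rewrite powRN ler_pdivlMr ?powR_gt0// mulrAC ler_pdivrMr ?exprn_gt0// cst.
  by have := J2; rewrite exprS => ?; nra.
have term j : (j0 <= j < J)%N -> (12 * d%:R / 2 ^+ j) `^ p * level_dev d n j.+1 <=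
    A `^ p * m `^ (- (b * p)) * (4 * 2 ^+ d * L).
  move=> /andP[jj jJ]; have q0 : 0 <= (2 ^+ j : R) by exact: exprn_ge0.
  apply: (@le_trans _ _ ((12 * d%:R / 2 ^+ j) `^ p *
     (4 * L * (((2 ^+ d) * (2 ^+ j) `^ (d%:R / 2)) * m `^ (- (1 / 2)))))).
    rewrite ler_wpM2l ?powR_ge0//; apply: (le_trans (devE _)).
    rewrite ler_wpM2l ?mulr_ge0// ler_wpM2r ?powR_ge0// exprS powRM// ler_wpM2r ?powR_ge0//.
    rewrite -powR_mulrn// ler_powR ?ler1n//.
    lra.
  rewrite -[12 * _ / _]mulrA; set q : R := 2 ^+ j in q0 *.
  have qp : 0 < q by exact: exprn_gt0.
  have -> : (12 * (d%:R / q)) `^ p = (A / 2) `^ p * q `^ (- p).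
    have Aq : 0 <= A / 2 by lra.
    have qV : 0 <= q^-1 by rewrite invr_ge0.
    by rewrite mulrA cst (powRM _ Aq qV) -(powR_inv1 q0) -powRrM mulN1r.
  have -> : (A / 2) `^ p * q `^ (- p) * (4 * L * (2 ^+ d * q `^ (d%:R / 2) * m `^ (- (1 / 2)))) =
    (A / 2) `^ p * (4 * 2 ^+ d * L) * (q `^ (d%:R / 2 - p) * m `^ (- (1 / 2))).
    rewrite powRD ?(gt_eqF qp) ?implybT//; ring.
  apply: (@le_trans _ _ ((A / 2) `^ p * (4 * 2 ^+ d * L) * (2 `^ p * m `^ (- (b * p))))).
    apply: ler_wpM2l; last exact: key.
    by rewrite mulr_ge0 ?powR_ge0// mulr_ge0// mulr_ge0// exprn_ge0.
  rewrite le_eqVlt; apply/orP; left; apply/eqP.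
  have -> : A `^ p = (A / 2) `^ p * 2 `^ p by rewrite -powRM ?divr_ge0// divfK.
  by ring.
apply: (@le_trans _ _ (A `^ p * m `^ (- (b * p)) * (1 + J%:R * (4 * 2 ^+ d * L)))).
  rewrite mulrDr mulr1; apply: lerD => //.
  apply: (@le_trans _ _ (\sum_(j0 <= j < J) A `^ p * m `^ (- (b * p)) * (4 * 2 ^+ d * L))).
    by rewrite big_nat [leRHS]big_nat; apply: ler_sum.
  rewrite sumr_const_nat -[_ *+ _]mulr_natl mulrCA.
  apply: ler_wpM2l; first by rewrite mulr_ge0 ?powR_ge0.
  apply: ler_wpM2r; last by rewrite ler_nat leq_subr.
  by rewrite !mulr_ge0// exprn_ge0.
have E0 : 0 <= E by lra.
have -> : (A * E * L `^ 2 * m `^ (- b)) `^ p =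
    A `^ p * m `^ (- (b * p)) * (E * L `^ 2) `^ p.
  rewrite -md -(powRM _ A0 mb0) -powRM; [|exact: mulr_ge0|].
    by congr (_ `^ _); ring.
  by rewrite mulr_ge0// powR_ge0.
apply: ler_wpM2l; first by rewrite mulr_ge0// powR_ge0.
have EL : 1 <= E * L `^ 2 by rewrite L2; nra.
apply: le_trans (le1r_powR EL p1); rewrite L2 /E.
have D1 : 1 <= (2 ^+ d : R) by rewrite exprn_ege1// ler1n.
have L2ge1 : 1 <= L ^+ 2 by rewrite exprn_ege1.
have JD : J%:R * (4 * 2 ^+ d * L) <= 2 * L * (4 * 2 ^+ d * L).
  by rewrite ler_wpM2r// !mulr_ge0// exprn_ge0.
have DL : 0 <= 2 ^+ d * L ^+ 2 by rewrite mulr_ge0// exprn_ge0.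
apply: (@le_trans _ _ (L ^+ 2 + 8 * (2 ^+ d * L ^+ 2))).
  by apply: lerD => //; apply: (le_trans JD); rewrite le_eqVlt; apply/orP; left;
    apply/eqP; ring.
have -> : (1 + 16 * 2 ^+ d) * L ^+ 2 = L ^+ 2 + 16 * (2 ^+ d * L ^+ 2) by ring.
by rewrite lerD2l ler_wpM2r// ler_nat.
Qed.

End rates.

(** * The good event and the final estimate *)

(** A single bad event serves all levels 0, ..., J, each failing with probability at most n ^ (- 3);
    off it the greedy matching is run separately for every outcome. *)
Lemma empirical_coupling (R : realType) (d n j0 J : nat) (p B : R)
    (dO : measure_display) (O : measurableType dO) (P : probability O R)
    (X : 'I_n -> O -> Rd R d) (mu : probability (Rd R d) R)
    (K : set 'rV[R]_d) (x0 : 'rV[R]_d) :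
  compact K -> (forall x y, K x -> K y -> eucl_dist x y <= 1) -> K x0 ->
  mu K = 1%E -> (0 < n)%N -> 1 <= ln n%:R :> R -> 1 <= p ->
  (forall i, has_law P (X i) mu) ->
  (forall A : 'I_n -> set (Rd R d), (forall i, measurable (A i)) ->
    fine (P (\bigcap_i (X i @^-1` A i))) = \prod_i fine (P (X i @^-1` A i))) ->
  (j0 <= J)%N ->
  (12 * d%:R / 2 ^+ J) `^ p +
    \sum_(j0 <= j < J) (12 * d%:R / 2 ^+ j) `^ p * level_dev R d n j.+1 <= B `^ p ->
  exists Bad : set O,
    [/\ measurable Bad, (P Bad <= (J.+1%:R * n%:R `^ (- 3))%:E)%E &
      forall w, ~ Bad w ->
        cell_coupling (@dyadic_cell R d J K x0) (@dyadic_corner R d J x0) (d%:R * (4 / 2 ^+ J)) p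
          mu (empirical (fun i => X i w)) (level_dev R d n j0) B].
Proof.
move=> cK diamK Kx0 muK n0 L1 p1 Xlaw Xindep j0J cost.
have p0 : 0 <= p by exact: le_trans p1.
have mQ := @measurable_dyadic_cell R d J K x0 cK.
have tQ := @trivIset_dyadic_cell R d J K x0.
set Q := @dyadic_cell R d J K x0 in mQ tQ *.
have H (j : 'I_J.+1) := empirical_excess n0 Xlaw Xindep (@ancestor d J j) mQ tQ
  (level_dev_ge0 R d n j).
pose bad (j : 'I_J.+1) := projT1 (cid (H j)).
have badP j := projT2 (cid (H j)).
exists (\bigcup_(j in [set j : 'I_J.+1 | true]) bad j); split.
- by apply: (fin_bigcup_measurable finite_finset) => j _; case: (badP j).
- apply: le_trans (measure_fin_bigcup_le _ _ _) _; first by move=> j; case: (badP j).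
  apply: (@le_trans _ _ (\sum_(j < J.+1) (n%:R `^ (- 3))%:E)%E).
    apply: lee_sum => j _; have [_ + _] := badP j; move=> /le_trans; apply.
    by rewrite lee_fin card_dyadic; exact: level_dev_fail.
  by rewrite sumEFin sumr_const card_ord -[_ *+ _]mulr_natl.
move=> w nbad; set emp := empirical _.
have [m mE] := empirical_probability (fun i => X i w) mu n0.
pose u := cell_mass Q mu; pose v := cell_mass Q emp.
have u0 a : 0 <= u a by exact/fine_ge0.
have v0 a : 0 <= v a by rewrite /v /emp -mE; exact/fine_ge0.
have excess j : (j <= J)%N -> level_excess (@ancestor d J) u v j <= level_dev R d n j.
  move=> jJ; have jJ' : (j < J.+1)%N by rewrite ltnS.
  have [_ _] := badP (Ordinal jJ'); apply=> bw; apply: nbad.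
  by exists (Ordinal jJ').
have [M [M0 Mu Mv Mmass Mcost]] :=
  tree_matching (@ancestor_nested d J) u0 v0 j0J.
have u1 : \sum_a u a = 1 by exact: dyadic_cell_mass.
exists M; split => //.
  by rewrite Mmass u1 lerD2l lerN2 excess.
pose C j : R := (12 * d%:R / 2 ^+ minn j J) `^ p.
have C0 j : 0 <= C j by exact: powR_ge0.
have cd j a b : ancestor j a = ancestor j b ->
    cell_dist (@dyadic_corner R d J x0) (d%:R * (4 / 2 ^+ J)) a b `^ p <= C j.
  move=> ab; rewrite ge0_ler_powR// ?nnegrE.
  - by rewrite addr_ge0 ?eucl_dist_ge0// !mulr_ge0// invr_ge0 exprn_ge0.
  - by rewrite !mulr_ge0// invr_ge0 exprn_ge0.
  - exact: dyadic_corner_dist.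
apply: le_trans (Mcost _ _ cd C0) _; apply: le_trans cost.
rewrite u1 mulr1 /C minnn lerD2l big_nat [leRHS]big_nat; apply: ler_sum => j /andP[_ jJ].
rewrite (minn_idPl (ltnW jJ)) ler_wpM2l ?powR_ge0//.
exact: excess.
Qed.

Theorem theorem3p7 (R : realType) (d : nat) (p k : R) :
  (1 <= d)%N -> 1 <= p -> 0 < k ->
  exists (c C a : R) (N : nat), 0 < c /\ 0 < C /\ 0 <= a /\
  forall (K : set 'rV[R]_d) (mu nu : probability (Rd R d) R) (n : nat),
    compact K ->
    (forall x y, K x -> K y -> eucl_dist x y <= 1) ->
    mu K = 1%E -> nu K = 1%E ->
    (N <= n)%N -> (1 <= n)%N ->
    forall (dO : measure_display) (O : measurableType dO) (P : probability O R)
           (X Y : 'I_n -> O -> Rd R d),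
      (forall i, has_law P (X i) mu) -> (forall i, has_law P (Y i) nu) ->
      indep_samples P X Y ->
      exists E : set O, measurable E /\
        (P E >= (1 - n%:R `^ (- c))%:E)%E /\
        forall w, E w ->
          (`| RPW p k mu nu
              - RPW p k (empirical (fun i => X i w)) (empirical (fun i => Y i w)) |
           <= (C * (ln n%:R) `^ a * rpw_rate d p n)%:E)%E.
Proof.
move=> d1 p1 k0; have [C0 C0gt0 bounds] := rate_bounds d1 p1.
(* This constant makes delta = 2 * B + 3 * B / k, which meets both demands of [RPW_transfer] since
   the dropped mass is at most B. The threshold on n exceeds e, so that ln n >= 1. *)
exists 1, (2 * C0 + 3 * C0 / k), 2, (Num.truncn (expR 1 : R)).+1.
split=> //; split; first by rewrite addr_gt0 ?mulr_gt0 ?invr_gt0.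
split=> // K mu nu n cK diamK muK nuK Nn n0 dO O P X Y Xlaw Ylaw indep.
have n0R : 0 < n%:R :> R by rewrite ltr0n.
have L1 : 1 <= ln n%:R :> R.
  rewrite -ler_expR lnK ?posrE//.
  have /andP[_ /ltW te] := truncn_itv (expR_ge0 (1 : R)).
  by apply: (le_trans te); rewrite ler_nat.
have n2 : (2 <= n)%N.
  by case: n n0 L1 {Nn n0R X Y Xlaw Ylaw indep} => [//|[|//]] _; rewrite ln1 ler10.
have [x0 Kx0] : exists x0, K x0.
  apply: contrapT => nK; have : (0 : \bar R) = 1%E.
    rewrite -muK -(measure0 mu); congr (mu _); apply/seteqP; split=> // x Kx.
    by apply: nK; exists x.
  by move=> /eqP; rewrite eqe eq_sym oner_eq0.
have mK : measurable (K : set (Rd R d)) by exact: compact_measurable_Rd.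
have mX i A : measurable A -> measurable (X i @^-1` A).
  by move=> mA; rewrite -[_ @^-1` _]setTI; exact: (Xlaw i).1.
have mY i A : measurable A -> measurable (Y i @^-1` A).
  by move=> mA; rewrite -[_ @^-1` _]setTI; exact: (Ylaw i).1.
have fullT (Z : 'I_n -> O -> Rd R d) : \bigcap_i (Z i @^-1` setT) = setT.
  by apply/seteqP; split.
have prodT (Z : 'I_n -> O -> Rd R d) : \prod_i fine (P (Z i @^-1` setT)) = 1.
  by apply: big1 => i _; rewrite preimage_setT probability_setT.
have Xindep (A : 'I_n -> set (Rd R d)) : (forall i, measurable (A i)) ->
    fine (P (\bigcap_i (X i @^-1` A i))) = \prod_i fine (P (X i @^-1` A i)).
  move=> mA; have := indep A (fun=> setT) mA (fun=> measurableT).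
  by rewrite fullT setIT prodT mulr1.
have Yindep (A : 'I_n -> set (Rd R d)) : (forall i, measurable (A i)) ->
    fine (P (\bigcap_i (Y i @^-1` A i))) = \prod_i fine (P (Y i @^-1` A i)).
  move=> mA; have := indep (fun=> setT) A (fun=> measurableT) mA.
  by rewrite fullT setTI prodT mul1r.
have [j0 [J [j0J Jn dev cost]]] := bounds n n0 L1.
set B := C0 * _ * _ in dev cost.
have B0 : 0 < B.
  rewrite !mulr_gt0 ?powR_gt0//; first exact: lt_le_trans L1.
  by rewrite /rpw_rate; case: ifP => _; exact: powR_gt0.
have [BX [mBX PBX cX]] := empirical_coupling cK diamK Kx0 muK n0 L1 p1 Xlaw Xindep j0J cost.
have [BY [mBY PBY cY]] := empirical_coupling cK diamK Kx0 nuK n0 L1 p1 Ylaw Yindep j0J cost.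
(* On this almost sure event the empirical measures live on K, so their cell masses sum to 1, as
   required for transferring from them back to mu and nu. *)
pose E0 := (\bigcap_i (X i @^-1` K)) `&` (\bigcap_i (Y i @^-1` K)).
have mE0 : measurable E0.
  apply: measurableI; apply: (fin_bigcap_measurable finite_finset) => i _.
    exact: mX.
  exact: mY.
have PE0 : P (~` E0) = 0%E.
  rewrite probability_setC//.
  have -> : P E0 = 1%E; last by rewrite subee.
  rewrite -[LHS]fineK ?fin_num_measure// (indep (fun=> K) (fun=> K))//.
  by rewrite !big1 ?mulr1// => i _; rewrite ?(Xlaw i).2 ?(Ylaw i).2 ?muK ?nuK.
have mBad : measurable ((BX `|` BY) `|` ~` E0).
  by apply: measurableU; [exact: measurableU|exact: measurableC].
exists (~` ((BX `|` BY) `|` ~` E0)); split; first exact: measurableC.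
split.
  rewrite probability_setC// EFinB leeB//.
  apply: le_trans (measureU2 _ (measurableU _ _ mBX mBY) (measurableC mE0)) _.
  rewrite [X in (_ + X)%E]PE0 adde0.
  apply: le_trans (measureU2 _ mBX mBY) _.
  apply: le_trans (leeD PBX PBY) _.
  rewrite -EFinD lee_fin -mulrDl.
  (* The two samples fail with total probability at most 2 * (J + 1) * n ^ (- 3), and 2 * (J + 1) <=
     2 * n <= n ^ 2 by J < n and n >= 2. *)
  have -> : - 1 = 2 + - 3 :> R by lra.
  rewrite powRD ?(gt_eqF n0R) ?implybT// ler_wpM2r ?powR_ge0// powR_mulrn//.
  have Jn' : (J.+1%:R : R) <= n%:R by rewrite ler_nat.
  have n2' : (2 : R) <= n%:R by rewrite ler_nat.
  by rewrite expr2; nra.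
move=> w /not_orP[/not_orP[nBX nBY] /contrapT[KX KY]].
have [mx mxE] := empirical_probability (fun i => X i w) mu n0.
have [my myE] := empirical_probability (fun i => Y i w) nu n0.
have := cX w nBX; have := cY w nBY; rewrite -mxE -myE => cy cx.
have emp1 (Z : 'I_n -> Rd R d) : (forall i, K (Z i)) -> empirical Z K = 1%E.
  move=> KZ; rewrite empiricalE (eq_bigr (fun=> 1)).
    by rewrite sumr_const card_ord divff// gt_eqF.
  by move=> i _; rewrite mem_set//; exact: KZ.
have mxK : mx K = 1%E by rewrite mxE emp1// => i; exact: KX.
have myK : my K = 1%E by rewrite myE emp1// => i; exact: KY.
set delta := _ * rpw_rate d p n.
have deltaE : delta = 2 * B + 3 * B / k by rewrite /delta /B; field; rewrite gt_eqF.
have Bk : 0 < B / k by rewrite divr_gt0.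
have sd : 2 * level_dev R d n j0 <= delta by rewrite deltaE -mulrA; lra.
have kd : 3 * B <= k * delta.
  have -> : k * delta = 2 * (k * B) + 3 * B by rewrite deltaE; field; rewrite gt_eqF.
  by rewrite lerDr; apply: mulr_ge0 => //; exact: mulr_ge0 (ltW k0) (ltW B0).
have h0 : 0 <= d%:R * (4 / 2 ^+ J) :> R by rewrite !mulr_ge0// invr_ge0 exprn_ge0.
have transfer := RPW_transfer p1 k0 (@measurable_dyadic_cell R d J K x0 cK)
  (@trivIset_dyadic_cell R d J K x0) (@dyadic_cell_corner R d J K x0) h0.
have mass1 (m : probability (Rd R d) R) :=
  @dyadic_cell_mass R d J K x0 cK diamK Kx0 m.
have le1 := transfer _ _ _ _ _ _ _ (mass1 _ muK) (mass1 _ nuK) cx cy B0 sd kd.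
have le2 := transfer _ _ _ _ _ _ _ (mass1 _ mxK) (mass1 _ myK)
  (cell_coupling_sym cx) (cell_coupling_sym cy) B0 sd kd.
have fin (m1 m2 : probability (Rd R d) R) : RPW p k m1 m2 \is a fin_num.
  rewrite ge0_fin_numE ?RPW_ge0//.
  exact: le_lt_trans (RPW_le1 p1 k0 _ _) (ltry 1).
rewrite -(fineK (fin mu nu)) -(fineK (fin mx my)) -!EFinD !lee_fin in le1 le2 *.
by rewrite ler_norml; lra.
Qed.
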